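(* For $\alpha>1$ let $\Lambda_\alpha=\Gamma(\alpha/2)^2/\Gamma(\alpha)$ and let $K_\alpha$ be the bounded operator on $L^2(\mathbb R_+)$ given by $$(K_\alpha F)(x)=\int_0^\infty(xy)^{(\alpha-1)/2}\bigl(\zeta(1+x+y)^\alpha-1\bigr)F(y)\,dy.$$ Then $\|K_2\|>\Lambda_2=1$. In particular, the set $$E:=\{\alpha>1:\|K_\alpha\|>\Lambda_\alpha\}$$ is non-empty.
   Context: $\mathbb R_+=(0,\infty)$, $\zeta$ is the Riemann zeta function, and $\|\cdot\|$ is the operator norm on $L^2(\mathbb R_+)$. *)

(* Defs.v *)
From HB Require Import structures.
From mathcomp Require Import all_boot all_order all_algebra.
From mathcomp Require Import all_classical all_reals all_analysis.

Set Implicit Arguments.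
Unset Strict Implicit.
Unset Printing Implicit Defensive.
Import Order.TTheory GRing.Theory Num.Theory.
Import numFieldNormedType.Exports.

Local Open Scope classical_set_scope.
Local Open Scope ring_scope.

Section SpecialFunctions.
Context (R : realType).
Implicit Types s alpha : R.

(* The Dirichlet series; only meaningful for s > 1. *)
Definition zeta s : R := limn (series (riemannR s)).

(* Euler's integral; only meaningful for s > 0. *)
Definition Gamma s : R :=
  \int[lebesgue_measure]_(t in `]0%R, +oo[) (t `^ (s - 1) * expR (- t)).

Definition Lambda alpha : R := Gamma (alpha / 2) ^+ 2 / Gamma alpha.

End SpecialFunctions.

Section L2Rplus.
Context (R : realType).

Definition Rplus : set (measurableTypeR R) := [set` `]0%R, +oo[ ].

Lemma measurable_Rplus : measurable Rplus.
Proof. exact: measurable_itv. Qed.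

Definition mu_plus : {measure set (measurableTypeR R) -> \bar R} :=
  mrestr lebesgue_measure measurable_Rplus.

(* An element of L^2(0, oo) is represented by a Borel function R -> R, of which
   only the values on (0, oo) matter: mu_plus does not charge the complement. *)
Definition L2 : set (measurableTypeR R -> R) :=
  [set F | F \in Lfun mu_plus 2%:E].

Definition L2norm (F : measurableTypeR R -> R) : \bar R :=
  ('N[mu_plus]_2%:E[EFin \o F])%E.

Implicit Type T : (measurableTypeR R -> R) -> (measurableTypeR R -> R).

(* A bounded linear operator on L^2(0, oo), given on representatives. The last
   two clauses imply that T respects almost everywhere equality. *)
Definition bounded_operator T : Prop :=
  [/\ forall F, L2 F -> L2 (T F),
      forall (a : R) F G, L2 F -> L2 G ->
        {ae mu_plus, forall x,
           T (fun y => a * F y + G y) x = a * T F x + T G x} &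
      exists M : R, forall F, L2 F -> (L2norm (T F) <= M%:E * L2norm F)%E].

Definition opnorm T : \bar R :=
  ereal_sup [set L2norm (T F) | F in [set F | L2 F /\ (L2norm F <= 1)%E]].

End L2Rplus.

Arguments Rplus R : clear implicits.

Section KOperator.
Context (R : realType).
Implicit Types (alpha : R) (F : measurableTypeR R -> R).

Definition Kkernel alpha (x y : R) : R :=
  (x * y) `^ ((alpha - 1) / 2) * (zeta (1 + x + y) `^ alpha - 1).

(* K_alpha F is extended by zero to x <= 0, where the kernel is meaningless. *)
Definition K alpha F : measurableTypeR R -> R :=
  (fun x => \int[lebesgue_measure]_(y in `]0%R, +oo[) (Kkernel alpha x y * F y))
    \_ (Rplus R).

(* The Lebesgue integral defining K_alpha F converges absolutely; [Rintegral]
   would otherwise return a default value. *)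
Definition K_well_defined alpha : Prop :=
  forall F, L2 F ->
    {ae mu_plus R, forall x,
       lebesgue_measure.-integrable `]0%R, +oo[
         (fun y : measurableTypeR R => (Kkernel alpha x y * F y)%:E)}.

Definition E : set R :=
  [set alpha | 1 < alpha /\ ((Lambda alpha)%:E < opnorm (K alpha))%E].

End KOperator.

Arguments E R : clear implicits.

(* Main.v *)
Require Import Defs.
From mathcomp Require Import all_boot all_order all_algebra.
From mathcomp Require Import all_classical all_reals all_analysis.
From mathcomp Require Import measurable_realfun ring lra.

Set Implicit Arguments.
Unset Strict Implicit.
Unset Printing Implicit Defensive.
Import Order.TTheory GRing.Theory Num.Theory.
Import numFieldNormedType.Exports.

Local Open Scope classical_set_scope.
Local Open Scope ring_scope.

(** Put [psi s = zeta (1 + s)^alpha - 1], so that the kernel is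
    [x^b y^b psi (x + y)] with [b = (alpha - 1) / 2].

    Boundedness is a Schur test with weight [y^(-b)]: this weight cancels one
    power, so only [int_0^oo psi (x + y) dy <= C x^(1 - alpha)] is needed, and
    that follows from [psi s <= C' s^(-alpha)].

    For [alpha = 2], where [Lambda_2 = Gamma(1)^2 / Gamma(2) = 1], take the unit
    vector [F x = 2 a sqrt x e^(-a x)] with [a = 8/5].  Comparing the Dirichlet
    series with integrals from [n = 2] on by the trapezoid rule gives
    [zeta (1 + s) >= 1 + 2^(-s) (1/s + 1/4)].  Squaring bounds [psi] below by a
    combination of [e^(-c s)], [e^(-c s) / s] and [e^(-c s) / s^2] with
    [c = ln 2] or [c = 2 ln 2]; all of these are Laplace transforms, so that by
    Tonelli their contributions to [<K_2 F, F>] are explicit, and the total is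
    at least [1.0047] since [ln 2 <= 7/10].  By AM-GM
    [2 <K_2 F, F> <= |K_2 F|^2 + |F|^2], hence [|K_2 F| > 1 = |F|]. *)

(** * Two-sided bounds for the zeta function on [(1, oo)] *)

Section Zeta.
Context (R : realType).
Implicit Types s t x : R.

Lemma powR_expR x s : 0 < x -> x `^ s = expR (s * ln x).
Proof. by move=> x0; rewrite /powR gt_eqF. Qed.

(** Convexity of [x^(-s)]: the graph lies above its tangent at [u]. Dividing by [u^(-s)] leaves
    [(t/u)^(-s) >= 1 + s (1 - t/u)], which combines [e^y >= 1 + y] with [ln y <= y - 1]. *)
Lemma powRN_tangent t u s : 0 < t -> t <= u -> 0 < s ->
  s * (u - t) * u `^ (- (1 + s)) <= t `^ (- s) - u `^ (- s).
Proof.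
move=> t0 tu s0.
have u0 : 0 < u by lra.
have uE : u `^ (- (1 + s)) = u `^ (- s) / u.
  by rewrite opprD powRD ?powR_inv1 ?(ltW u0)// 1?mulrC// (gt_eqF u0) implybT.
have tu0 : 0 < t / u by exact: divr_gt0.
have -> : t `^ (- s) = u `^ (- s) * (t / u) `^ (- s).
  by rewrite -powRM ?(ltW u0) ?(ltW tu0)// mulrC divfK ?gt_eqF.
have : 1 + s * (1 - t / u) <= (t / u) `^ (- s).
  rewrite powR_expR//; apply: le_trans (expR_ge1Dx _).
  rewrite lerD2l mulNr -mulrN ler_wpM2l ?(ltW s0)// lerNr opprB.
  by rewrite -[in leLHS](subrK 1 (t / u)) addrC le_ln1Dx// ltrBDl subrr.
move=> /(ler_wpM2l (powR_ge0 u (- s))).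
have -> : s * (u - t) * u `^ (- (1 + s)) = s * (1 - t / u) * u `^ (- s).
  by rewrite uE; field; rewrite gt_eqF.
by lra.
Qed.

(** The trapezoid rule overestimates the integral of the convex function [x^(-(1+s))] over
    [[t, t+1]]. With a variable right end [u], the error times [2 s] is [f u]; it vanishes at [t],
    and its derivative is nonnegative by the tangent inequality with exponent [1 + s]. *)
Lemma powRN_trapezoid t s : 0 < t -> 0 < s ->
  2 * (t `^ (- s) - (t + 1) `^ (- s)) <=
  s * (t `^ (- (1 + s)) + (t + 1) `^ (- (1 + s))).
Proof.
move=> t0 s0.
pose c := t `^ (- (1 + s)); pose d := t `^ (- s).
pose f u := s * ((u - t) * (c + u `^ (- (1 + s)))) + 2 * (u `^ (- s) - d).
pose f' u := s * (c - u `^ (- (1 + s)) -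
                  (1 + s) * (u - t) * u `^ (- (1 + (1 + s)))).
have df u : t <= u -> is_derive u 1 f (f' u).
  move=> tu; have u0 : 0 < u by lra.
  have -> : f = cst s * ((@id R - cst t) * (cst c + @powR R ^~ (- (1 + s)))) +
                cst 2 * (@powR R ^~ (- s) - cst d) by [].
  have d1 := is_derive1_powR (- (1 + s)) u0.
  have d2 := is_derive1_powR (- s) u0.
  apply: is_derive_eq.
  rewrite /f' /GRing.scale /=.
  have e1 : - (1 + s) - 1 = - (1 + (1 + s)) by ring.
  have e2 : - s - 1 = - (1 + s) by ring.
  rewrite e1 e2 !fctE.
  move: (u `^ - (1 + (1 + s))) (u `^ - (1 + s)) => p q; ring.
have cf : {within `[t, t + 1], continuous f}.
  apply: derivable_within_continuous => u; rewrite in_itv/= => /andP[tu _].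
  by have [] := df u tu.
have [||u + fE] := @MVT_segment R f f' t (t + 1) _ _ cf.
- by rewrite lerDl.
- by move=> u; rewrite in_itv/= => /andP[/ltW tu _]; exact: df.
rewrite in_itv/= => /andP[tu _].
have ft : f t = 0 by rewrite /f /d subrr mul0r mulr0 subrr mulr0 add0r.
move: fE; rewrite ft subr0 (addrC t) addrK mulr1 addrC => fE.
have : 0 <= f' u.
  rewrite mulr_ge0 ?(ltW s0)// subr_ge0.
  by apply: powRN_tangent => //; rewrite addr_gt0.
by rewrite -fE /f -/c -/d (addrC t) addrK mul1r; lra.
Qed.

Lemma cvgy_powRN s : 0 < s -> x `^ (- s) @[x --> +oo] --> (0 : R).
Proof.
move=> s0; apply/cvgrPdist_le => e e0; near=> x.
have x0 : 0 < x by [].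
rewrite sub0r normrN ger0_norm ?powR_ge0// powRN.
rewrite -[leRHS]invrK lef_pV2 ?posrE ?invr_gt0 ?powR_gt0//.
have -> : e^-1 = (e^-1 `^ s^-1) `^ s.
  by rewrite -powRrM mulVf ?gt_eqF// powRr1// invr_ge0 ltW.
by rewrite ge0_ler_powR ?(ltW s0)// ?nnegrE ?powR_ge0// ?(ltW x0).
Unshelve. all: by end_near. Qed.

(** The integral of [x^(-(1+s))] over [[n+1, oo)]. The shift follows [riemannR], whose entry [n]
    belongs to the integer [n + 1]. *)
Let u s n := n.+1%:R `^ (- s) / s.

Lemma riemannRE s n : riemannR s n = n.+1%:R `^ (- s).
Proof. by rewrite powRN. Qed.

Lemma riemannR_ge0 s n : 0 <= riemannR s n.
Proof. by rewrite riemannRE powR_ge0. Qed.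

(** On [[n+1, n+2]] the decreasing function [x^(-(1+s))] is at least its value at the right end. *)
Lemma riemannR_le_telescope s n : 0 < s ->
  riemannR (1 + s) n.+1 <= u s n - u s n.+1.
Proof.
move=> s0; rewrite riemannRE /u -mulrBl ler_pdivlMr// mulrC.
have := @powRN_tangent n.+1%:R n.+2%:R s; rewrite ltr0n ler_nat leqnSn.
by rewrite -natrB// subSnn mulr1; exact.
Qed.

(** The trapezoid rule on [[n+1, n+2]], divided by [2 s]. *)
Lemma riemannR_ge_telescope s n : 0 < s ->
  u s n - u s n.+1 <= (riemannR (1 + s) n + riemannR (1 + s) n.+1) / 2.
Proof.
move=> s0; rewrite !riemannRE /u -mulrBl ler_pdivrMr//.
have := @powRN_trapezoid n.+1%:R s; rewrite ltr0n natr1 => /(_ isT s0).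
by lra.
Qed.

(** The terms of 1 and 2 stay exact and the comparison with the integral starts at 2. Starting at 1
    would lose the factor [2^(-s)], hence the exponential decay of [zeta - 1]. *)
Lemma series_riemannR_le s n : 0 < s ->
  series (riemannR (1 + s)) n.+2 <= 1 + 2 `^ (- (1 + s)) + u s 1 - u s n.+1.
Proof.
move=> s0; elim: n => [|n IH].
  by rewrite /series/= !big_nat_recr//= big_nil !riemannRE powR1 add0r addrK.
rewrite /series/= big_nat_recr//=; have := riemannR_le_telescope n.+1 s0.
by move: IH; rewrite /series/=; lra.
Qed.

(** The trapezoid rule uses only half of the end terms, those of 2 and [n + 2]; the other halves
    appear separately. *)
Lemma series_riemannR_ge s n : 0 < s ->
  1 + 2 `^ (- (1 + s)) / 2 + u s 1 - u s n.+1 + riemannR (1 + s) n.+1 / 2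
    <= series (riemannR (1 + s)) n.+2.
Proof.
move=> s0; elim: n => [|n IH].
  by rewrite /series/= !big_nat_recr//= big_nil !riemannRE powR1 add0r addrK;
     lra.
rewrite /series/= big_nat_recr//=; have := riemannR_ge_telescope n.+1 s0.
by move: IH; rewrite /series/=; lra.
Qed.

Lemma nondecreasing_series_riemannR s : nondecreasing_seq (series (riemannR s)).
Proof.
by apply/nondecreasing_seqP => n; rewrite seriesSr lerDl riemannR_ge0.
Qed.

Lemma is_cvg_series_riemannR s : 0 < s -> cvgn (series (riemannR (1 + s))).
Proof.
move=> s0; apply: nondecreasing_is_cvgn.
  exact: nondecreasing_series_riemannR.
exists (1 + 2 `^ (- (1 + s)) + u s 1) => _ [n _ <-].
apply: (@le_trans _ _ (series (riemannR (1 + s)) n.+2)).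
  by apply: nondecreasing_series_riemannR; rewrite -addn2 leq_addr.
apply: le_trans (series_riemannR_le n s0) _.
by rewrite gerBl divr_ge0 ?powR_ge0 ?ltW.
Qed.

Lemma powR2N1 s : 2 `^ (- (1 + s)) = 2 `^ (- s) / 2.
Proof.
by rewrite opprD powRD ?powR_inv1 1?mulrC// pnatr_eq0 implybT.
Qed.

Lemma zeta_le s : 0 < s -> zeta (1 + s) <= 1 + 2 `^ (- s) * (s^-1 + 2^-1).
Proof.
move=> s0; apply: limr_le; first exact: is_cvg_series_riemannR.
near=> n; rewrite /=.
apply: (@le_trans _ _ (series (riemannR (1 + s)) n.+2)).
  by apply: nondecreasing_series_riemannR; rewrite -addn2 leq_addr.
apply: le_trans (series_riemannR_le n s0) _.
rewrite powR2N1 {1}/u.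
have : 0 <= u s n.+1 by rewrite divr_ge0 ?powR_ge0 ?ltW.
by lra.
Unshelve. all: by end_near. Qed.

(** The constant is [1/4] where the upper bound has [1/2], because the trapezoid rule leaves only
    half of the term [2^(-(1+s)) = 2^(-s) / 2]. The tail [u s n.+1] disappears in the limit. *)
Lemma zeta_ge s : 0 < s -> 1 + 2 `^ (- s) * (s^-1 + 4^-1) <= zeta (1 + s).
Proof.
move=> s0.
have cu : u s n.+1 @[n --> \oo] --> (0 : R).
  rewrite -[X in _ --> X](mul0r s^-1); apply: cvgMl.
  have /cvg_pinftyP h := cvgy_powRN s0.
  apply: (h (fun n => n.+2%:R)); have := @cvgr_idn R.
  by rewrite -(@cvg_shiftn 2); under eq_fun do rewrite addn2.
pose c := 1 + 2 `^ (- s) * (s^-1 + 4^-1).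
have cc : c - u s n.+1 @[n --> \oo] --> c.
  by rewrite -[X in _ --> X]subr0; apply: cvgB => //; exact: cvg_cst.
apply: (cvgr_to_le cc); near=> n.
apply: (@le_trans _ _ (series (riemannR (1 + s)) n.+2)); last first.
  apply: nondecreasing_cvgn_le; first exact: nondecreasing_series_riemannR.
  exact: is_cvg_series_riemannR.
apply: le_trans (series_riemannR_ge n s0).
have := riemannR_ge0 (1 + s) n.+1; rewrite /c powR2N1 [u s 1]/u.
by lra.
Unshelve. all: by end_near. Qed.

Lemma zeta_gt1 s : 0 < s -> 1 < zeta (1 + s).
Proof.
move=> s0; apply: lt_le_trans (zeta_ge s0).
by rewrite ltrDl mulr_gt0 ?powR_gt0// addr_gt0 ?invr_gt0.
Qed.

Lemma measurable_zeta :
  measurable_fun (`]0, +oo[ : set R) (fun s : R => zeta (1 + s)).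
Proof.
have mr k : measurable_fun (`]0, +oo[ : set R) (fun s => riemannR (1 + s) k).
  rewrite (_ : (fun s => _) = @powR R k.+1%:R \o (fun s => - (1 + s))).
    apply: measurableT_comp; first exact: measurable_powRr.
    by apply: measurable_funN; exact: measurable_funD.
  by apply/funext => s /=; rewrite powRN.
apply: (measurable_fun_cvg (h := fun n s => series (riemannR (1 + s)) n)).
  by move=> n; apply: measurable_sum => k; exact: mr.
by move=> s; rewrite /= in_itv/= andbT => s0; exact: is_cvg_series_riemannR.
Qed.

End Zeta.

(** * Behaviour of [psi] near 0 and at infinity *)

Section Psi.
Context (R : realType).
Implicit Types s x y alpha : R.

Definition psi alpha s : R := zeta (1 + s) `^ alpha - 1.

Lemma psi_ge0 alpha s : 0 <= alpha -> 0 < s -> 0 <= psi alpha s.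
Proof.
move=> a0 s0; rewrite subr_ge0 -[leLHS](powRr0 (zeta (1 + s))).
by rewrite ler_powR// ltW// zeta_gt1.
Qed.

(** This is [ln y < y] at [y = c s / a], multiplied by [a]. It trades exponential decay for decay of
    any order [a]. *)
Lemma expRN_le_powRN (c a s : R) : 0 < c -> 0 < a -> 0 < s ->
  expR (- (c * s)) <= (c / a) `^ (- a) * s `^ (- a).
Proof.
move=> c0 a0 s0; have ca0 : 0 < c / a by rewrite divr_gt0.
rewrite -powRM ?(ltW ca0) ?(ltW s0)// powR_expR ?(mulr_gt0 ca0)//.
rewrite ler_expR mulNr lerN2.
have := ln_sublinear (mulr_gt0 ca0 s0) => /ltW /(ler_wpM2l (ltW a0)).
by rewrite [leRHS](_ : _ = c * s)//; field; rewrite gt_eqF.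
Qed.

(** The bound [z^(-alpha) >= 1 - alpha (z - 1)] is multiplied by [z^alpha]. For large [s] it turns
    the decay of [zeta - 1] into decay of [psi]. *)
Lemma psi_le_linear alpha s : 0 < alpha -> 0 < s ->
  psi alpha s <= zeta (1 + s) `^ alpha * (alpha * (zeta (1 + s) - 1)).
Proof.
move=> a0 s0; rewrite /psi; set z := zeta _.
have z1 : 1 < z by exact: zeta_gt1.
have zp : 0 < z by exact: lt_trans z1.
have h : 1 - alpha * (z - 1) <= z `^ (- alpha).
  rewrite powR_expR//; apply: le_trans (expR_ge1Dx _).
  rewrite mulNr lerD2l lerN2 ler_wpM2l ?(ltW a0)//.
  by rewrite -[in leLHS](subrK 1 z) addrC le_ln1Dx//; lra.
have := ler_wpM2l (powR_ge0 z alpha) h.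
by rewrite powRN divff ?gt_eqF ?powR_gt0//; lra.
Qed.

(** For [s <= 1] the pole of zeta dictates the power; for [s > 1] the decay like [2^(-s)] is
    converted into that power. The sum of the two constants serves both ranges. *)
Lemma psi_le_powRN alpha : 0 < alpha ->
  exists2 C, 0 < C & forall s, 0 < s -> psi alpha s <= C * s `^ (- alpha).
Proof.
move=> a0; have l2 : 0 < ln (2 : R) by rewrite ln_gt0// ltr1n.
pose M := (ln 2 / alpha) `^ (- alpha).
have M0 : 0 < M by rewrite powR_gt0// divr_gt0.
pose D : R := (5 / 2) `^ alpha; have D0 : 0 < D by rewrite powR_gt0.
have D' : 0 < D * (alpha * (3 / 2 * M)).
  by rewrite !mulr_gt0.
exists (D + D * (alpha * (3 / 2 * M))); first exact: addr_gt0.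
move=> s s0.
have z1 := zeta_gt1 s0; have := zeta_le s0.
set z := zeta _ in z1 * => zle.
have p2 : 2 `^ (- s) <= 1.
  by rewrite -[leRHS](powRr0 (2 : R)) ler_powR ?ler1n//; lra.
have p20 : 0 < (2 : R) `^ (- s) by rewrite powR_gt0.
have sa0 : 0 <= s `^ (- alpha) by exact: powR_ge0.
have sv0 : 0 < s^-1 by rewrite invr_gt0.
(* For [s <= 1] one has [zeta <= 1 + 1/s + 1/2 <= (5/2) / s], whence the base [5/2] in [D]. *)
have [s1|s1] := leP s 1.
  have sv : 1 <= s^-1 by rewrite invf_ge1.
  have z52 : z <= 5 / 2 * s^-1.
    apply: le_trans zle _.
    have := @ler_pM R _ _ _ _ (ltW p20) (_ : 0 <= s^-1 + 2^-1) p2 (lexx _).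
    by rewrite addr_ge0 ?(ltW sv0)// => /(_ isT); lra.
  apply: (@le_trans _ _ (z `^ alpha)); first by rewrite /psi -/z gerBl.
  apply: (@le_trans _ _ (D * s `^ (- alpha))).
    rewrite powRN -powR_inv1 ?powR_ge0// powRAC powR_inv1 ?(ltW s0)//.
    rewrite -powRM ?(ltW sv0)//.
    by apply: ge0_ler_powR; rewrite ?nnegrE; lra.
  by rewrite ler_wpM2r// lerDl ltW.
have sv1 : s^-1 < 1 by rewrite invf_lt1.
(* For [s > 1] the factor [1/s + 1/2] is at most [3/2]; so [z <= 5/2], and [D] bounds [z^alpha]
   again. *)
have z52 : z <= 1 + 3 / 2 * 2 `^ (- s).
  apply: le_trans zle _; rewrite lerD2l mulrC ler_wpM2r ?(ltW p20)//; lra.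
apply: le_trans (psi_le_linear a0 s0) _; rewrite -/z.
apply: (@le_trans _ _ (D * (alpha * (3 / 2 * 2 `^ (- s))))).
  apply: ler_pM; rewrite ?powR_ge0 ?mulr_ge0 ?(ltW a0)//; first lra.
    by apply: ge0_ler_powR; rewrite ?nnegrE; lra.
  by rewrite ler_wpM2l ?(ltW a0)//; lra.
apply: (@le_trans _ _ (D * (alpha * (3 / 2 * M)) * s `^ (- alpha))); last first.
  by rewrite ler_wpM2r// lerDr ltW.
rewrite [leRHS](_ : _ = D * (alpha * (3 / 2 * (M * s `^ (- alpha))))); last ring.
rewrite !ler_wpM2l ?(ltW D0) ?(ltW a0)//.
have := expRN_le_powRN l2 a0 s0; rewrite -/M.
by rewrite (@powR_expR _ 2)// mulNr (mulrC s).
Qed.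

Lemma measurable_psi alpha : measurable_fun (`]0, +oo[ : set R) (psi alpha).
Proof.
apply: measurable_funB => //.
apply: (@measurableT_comp _ _ _ _ _ _ (fun x : R => x `^ alpha)).
  exact: measurable_powR.
exact: measurable_zeta.
Qed.

End Psi.

(** * Improper integrals by the fundamental theorem of calculus *)

Section Integrals.
Context (R : realType).
Notation mu := (@lebesgue_measure R).
Implicit Types x y alpha b : R.

Lemma is_derive_continuous (f : R -> R) x l :
  is_derive x 1 f l -> {for x, continuous f}.
Proof.
by case=> df _; exact/differentiable_continuous/derivable1_diffP.
Qed.

(** The endpoint 0 is a null set, so the integral may be taken over [[0, oo)]; this is why the
    hypotheses include [y = 0]. *)
Lemma integral_oy_FTC (f F : R -> R) :
  (forall y, 0 <= y -> 0 <= f y) -> (forall y, 0 <= y -> {for y, continuous f}) ->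
  (forall y, 0 <= y -> is_derive y 1 F (f y)) ->
  F y @[y --> +oo] --> 0 ->
  (\int[mu]_(y in `]0%R, +oo[) (f y)%:E)%E = (- F 0)%:E.
Proof.
move=> f0 cf dF Fy.
have mf : measurable_fun (`]0, +oo[ : set R) f.
  apply: open_continuous_measurable_fun => // y.
  by rewrite inE/= in_itv/= andbT => /ltW; exact: cf.
rewrite integral_itv_obnd_cbnd; last exact/measurable_EFinP.
rewrite (@ge0_continuous_FTC2y _ f F 0 0)//.
- by rewrite sub0e.
- apply: continuous_in_subspaceT => y.
  by rewrite inE/= in_itv/= andbT; exact: cf.
- by move=> y /ltW y0; have [] := dF y y0.
- apply: cvg_at_right_filter.
  exact: is_derive_continuous (dF 0 (lexx _)).
- move=> y; rewrite in_itv/= andbT => /ltW y0.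
  by rewrite derive1E; have [_] := dF y y0.
Qed.

(** Serves the Schur test and, at integer exponents, the Laplace transforms. *)
Lemma integral_powRN x alpha : 0 < x -> 1 < alpha ->
  (\int[mu]_(y in `]0%R, +oo[) ((x + y) `^ (- alpha))%:E)%E =
  (x `^ (1 - alpha) / (alpha - 1))%:E.
Proof.
move=> x0 a1.
pose F y := - (alpha - 1)^-1 * (x + y) `^ (1 - alpha).
have dF y : 0 <= y -> is_derive y 1 F ((x + y) `^ (- alpha)).
  move=> y0; have xy : 0 < x + y by lra.
  have -> : F = cst (- (alpha - 1)^-1) *
                ((@powR R ^~ (1 - alpha)) \o (cst x + @id R)) by [].
  have d1 := is_derive1_powR (1 - alpha) xy.
  have d2 : is_derive y 1 ((@powR R ^~ (1 - alpha)) \o (cst x + @id R))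
       ((1 - alpha) * (x + y) `^ (1 - alpha - 1) * (0 + 1)).
    exact: is_derive1_comp.
  apply: is_derive_eq; rewrite /GRing.scale/= mulr0 addr0 add0r mulr1.
  rewrite (_ : 1 - alpha - 1 = - alpha); last by ring.
  by rewrite mulrA (_ : _ * (1 - alpha) = 1) ?mul1r//; field; lra.
rewrite (@integral_oy_FTC _ F) //.
- by rewrite /F addr0 mulNr opprK mulrC.
- by move=> y _; exact: powR_ge0.
- move=> y y0; have xy : 0 < x + y by lra.
  have d1 := is_derive1_powR (- alpha) xy.
  have /is_derive_continuous// : is_derive y 1
      ((@powR R ^~ (- alpha)) \o (cst x + @id R))
      (- alpha * (x + y) `^ (- alpha - 1) * (0 + 1)).
  exact: is_derive1_comp.
- rewrite -[X in _ --> X](mulr0 (- (alpha - 1)^-1)); apply: cvgMr.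
  have a10 : 0 < alpha - 1 by lra.
  have := cvgy_powRN a10; rewrite opprB => h.
  apply: (cvg_comp (fun y => x + y) _ _ h).
  apply/cvgryPge => A; near=> y; rewrite -lerBlDl; near: y.
  exact: (nbhs_pinfty_ge (num_real _)).
Unshelve. all: by end_near. Qed.

End Integrals.

(** * Tonelli's theorem on the open quadrant *)

Section Quadrant.
Context (R : realType).
Notation mu := (@lebesgue_measure R).
Notation P := (Rplus R).
Notation TR := (measurableTypeR R).
Local Open Scope ereal_scope.

Lemma RplusE (x : R) : P x = (0 < x)%R :> Prop.
Proof. by rewrite /Rplus/= in_itv/= andbT. Qed.

Lemma measurable_quadrant : measurable (P `*` P : set (TR * TR)).
Proof. by apply: measurableX; exact: measurable_Rplus. Qed.

Variable f : TR * TR -> \bar R.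
Hypothesis mf : measurable_fun (P `*` P) f.
Hypothesis f0 : forall x y, P x -> P y -> 0 <= f (x, y).

(** Extension by zero to the plane, where Tonelli applies; the inner integrals of [g] are those of
    [f] on [P] and vanish off [P]. *)
Let g := f \_ (P `*` P).

Let mg : measurable_fun setT g.
Proof.
by apply/(measurable_restrictT _ measurable_quadrant).
Qed.

Let g0 z : 0 <= g z.
Proof.
rewrite /g /patch; case: ifPn => //; rewrite inE; case: z => x y [/=].
exact: f0.
Qed.

Let integral_g1 x : P x -> \int[mu]_y g (x, y) = \int[mu]_(y in P) f (x, y).
Proof.
move=> Px; rewrite [RHS]integral_mkcond; apply: eq_integral => y _.
rewrite /g /patch; have [Py|Py] := boolP (y \in P).
  by rewrite mem_set//; split => //; exact: set_mem.
by rewrite memNset// => -[_ /= Py']; move: Py; rewrite mem_set.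
Qed.

Let integral_g2 y : P y -> \int[mu]_x g (x, y) = \int[mu]_(x in P) f (x, y).
Proof.
move=> Py; rewrite [RHS]integral_mkcond; apply: eq_integral => x _.
rewrite /g /patch; have [Px|Px] := boolP (x \in P).
  by rewrite mem_set//; split => //; exact: set_mem.
by rewrite memNset// => -[/= Px' _]; move: Px; rewrite mem_set.
Qed.

Let integral_g1_out x : ~ P x -> \int[mu]_y g (x, y) = 0.
Proof.
by move=> Px; apply: integral0_eq => y _; rewrite /g /patch memNset// => -[].
Qed.

Let integral_g2_out y : ~ P y -> \int[mu]_x g (x, y) = 0.
Proof.
by move=> Py; apply: integral0_eq => x _; rewrite /g /patch memNset// => -[].
Qed.

Lemma tonelli_quadrant :
  \int[mu]_(x in P) \int[mu]_(y in P) f (x, y) =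
  \int[mu]_(y in P) \int[mu]_(x in P) f (x, y).
Proof.
transitivity (\int[mu]_x \int[mu]_y g (x, y)).
  rewrite integral_mkcond; apply: eq_integral => x _; rewrite /patch.
  case: ifPn => [/set_mem Px|]; first by rewrite integral_g1.
  by rewrite notin_setE => /integral_g1_out.
rewrite fubini_tonelli//.
rewrite [RHS]integral_mkcond; apply: eq_integral => y _; rewrite /patch.
case: ifPn => [/set_mem Py|]; first by rewrite integral_g2.
by rewrite notin_setE => /integral_g2_out.
Qed.

Lemma measurable_integral_quadrant :
  measurable_fun P (fun x => \int[mu]_(y in P) f (x, y)).
Proof.
apply: (@eq_measurable_fun _ _ _ _ _ (fun x => \int[mu]_y g (x, y))).
  by move=> x /set_mem /integral_g1.
apply: measurable_funTS.
exact: (measurable_fun_fubini_tonelli_F (m2 := mu) g).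
Qed.

End Quadrant.

(** * Measurability of one-variable functions lifted to the quadrant *)

Section QuadrantMeasurability.
Context (R : realType).
Notation P := (Rplus R).
Notation TR := (measurableTypeR R).

Lemma measurable_quadrant_fst (h : TR -> R) :
  measurable_fun P h -> measurable_fun (P `*` P) (fun z : TR * TR => h z.1).
Proof.
move=> mh; apply: (measurable_comp (F := P) (f := h) (g := fst)) => //.
- exact: measurable_Rplus.
- by move=> _ [[x y] [Px _] <-].
- by apply: measurable_funTS; exact: measurable_fst.
Qed.

Lemma measurable_quadrant_snd (h : TR -> R) :
  measurable_fun P h -> measurable_fun (P `*` P) (fun z : TR * TR => h z.2).
Proof.
move=> mh; apply: (measurable_comp (F := P) (f := h) (g := snd)) => //.
- exact: measurable_Rplus.
- by move=> _ [[x y] [_ Py] <-].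
- by apply: measurable_funTS; exact: measurable_snd.
Qed.

Lemma measurable_quadrant_add (h : TR -> R) :
  measurable_fun P h -> measurable_fun (P `*` P) (fun z : TR * TR => h (z.1 + z.2)).
Proof.
move=> mh.
apply: (measurable_comp (F := P) (f := h) (g := fun z : TR * TR => z.1 + z.2)) => //.
- exact: measurable_Rplus.
- by move=> _ [[x y] [/= Px Py] <-]; move: Px Py; rewrite !RplusE; exact: addr_gt0.
- by apply: measurable_funTS; apply: measurable_funD;
    [exact: measurable_fst|exact: measurable_snd].
Qed.

End QuadrantMeasurability.

(** * The norm of [L^2(0, oo)] in terms of Lebesgue measure *)

Section L2norm.
Context (R : realType).
Notation mu := (@lebesgue_measure R).
Notation P := (Rplus R).
Notation TR := (measurableTypeR R).
Local Open Scope ereal_scope.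

(** The squared norm, written without root or restricted measure so that Tonelli and monotonicity
    apply directly. *)
Definition sqint (F : TR -> R) : \bar R := \int[mu]_(x in P) ((F x) ^+ 2)%:E.

Lemma sqint_ge0 F : 0 <= sqint F.
Proof. by apply: integral_ge0 => x _; rewrite lee_fin sqr_ge0. Qed.

(** The complement of [P] is null for [mu_plus], and on subsets of [P] both measures agree. *)
Lemma ge0_integral_mu_plus (f : TR -> \bar R) :
  measurable_fun setT f -> (forall x, 0 <= f x) ->
  \int[mu_plus R]_x f x = \int[mu]_(x in P) f x.
Proof.
move=> mf f0; have mP := @measurable_Rplus R.
have mPC : measurable (~` P) by exact: measurableC.
rewrite (ge0_negligible_integral mPC)//; last first.
  by rewrite /mu_plus/= /mrestr setICl measure0.
rewrite setDE setTI setCK; apply: eq_measure_integral => A mA AP.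
by rewrite /mu_plus/= /mrestr; congr (mu _); exact/setIidPl.
Qed.

Lemma L2normE F : measurable_fun setT F -> L2norm F = sqint F `^ (2^-1).
Proof.
move=> mF; rewrite /L2norm unlock; congr (_ `^ _).
have e x : `|(EFin \o F) x| `^ 2 = ((F x) ^+ 2)%:E.
  by rewrite /= powR_mulrn// real_normK// num_real.
under eq_integral do rewrite e.
apply: ge0_integral_mu_plus => [|x]; last by rewrite lee_fin sqr_ge0.
by apply/measurable_EFinP; exact: measurable_funX.
Qed.

Lemma L2P F : L2 F <-> measurable_fun setT F /\ sqint F < +oo.
Proof.
rewrite /L2/= inE; split.
  move=> /andP[]; rewrite !inE/= => mF; rewrite /finite_norm -/(L2norm F).
  rewrite L2normE// => h; split => //.
  exact: lty_poweRy h.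
move=> [mF h]; apply/andP; split; rewrite inE//=.
by rewrite /finite_norm -/(L2norm F) L2normE//; exact: poweR_lty.
Qed.

(** The exceptional set may be enlarged by the complement of [P], which [mu_plus] does not
    charge. *)
Lemma ae_mu_plus (Q : TR -> Prop) :
  {ae mu, forall x, P x -> Q x} -> {ae mu_plus R, forall x, Q x}.
Proof.
move=> [N [mN N0 QN]]; exists (N `|` ~` P); split.
- by apply: measurableU => //; apply: measurableC; exact: measurable_Rplus.
- rewrite /mu_plus/= /mrestr setIUl setICl setU0.
  apply/eqP; rewrite -measure_le0 -N0 le_measure// ?inE//.
  by apply: measurableI => //; exact: measurable_Rplus.
- move=> x /= nQ; have [Px|] := pselect (P x); last by right.
  by left; apply: QN => /= /(_ Px).
Qed.

Lemma ae_mu_plus_lebesgue (Q : TR -> Prop) :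
  {ae mu_plus R, forall x, Q x} -> {ae mu, forall x, P x -> Q x}.
Proof.
move=> [N [mN N0 QN]]; exists (N `&` P); split => //.
- by apply: measurableI => //; exact: measurable_Rplus.
- by move=> x /= /not_implyP[Px nQ]; split => //; exact: QN.
Qed.

End L2norm.

(** * The Schur test for [K alpha] *)

Section Schur.
Context (R : realType).
Notation mu := (@lebesgue_measure R).
Notation P := (Rplus R).
Notation TR := (measurableTypeR R).
Implicit Types x y l alpha : R.

Lemma KkernelE alpha x y : 0 < x -> 0 < y ->
  Kkernel alpha x y =
  x `^ ((alpha - 1) / 2) * y `^ ((alpha - 1) / 2) * psi alpha (x + y).
Proof. by move=> x0 y0; rewrite /Kkernel /psi addrA powRM ?ltW. Qed.

Lemma measurable_add_l (h : TR -> R) (x : R) : 0 < x ->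
  measurable_fun P h -> measurable_fun P (fun y : TR => h (x + y)).
Proof.
move=> x0 mh.
apply: (measurable_comp (F := P) (f := h) (g := fun y : TR => x + y)) => //.
- exact: measurable_Rplus.
- by move=> _ [y Py <-]; move: Py; rewrite !RplusE; exact: addr_gt0.
- by apply: measurable_funTS; exact: measurable_funD.
Qed.

Lemma measurable_Kkernel alpha :
  measurable_fun (P `*` P) (fun z : TR * TR => Kkernel alpha z.1 z.2).
Proof.
apply: (@eq_measurable_fun _ _ _ _ _ (fun z : TR * TR =>
  z.1 `^ ((alpha - 1) / 2) * z.2 `^ ((alpha - 1) / 2) * psi alpha (z.1 + z.2))).
  move=> [x y]; rewrite inE => -[/=]; rewrite !RplusE => x0 y0.
  by rewrite KkernelE.
have mp : measurable_fun P (fun x : TR => x `^ ((alpha - 1) / 2)).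
  by apply: measurable_funTS; exact: measurable_powR.
apply: measurable_funM; first apply: measurable_funM.
- exact: (measurable_quadrant_fst mp).
- exact: (measurable_quadrant_snd mp).
- apply: (@measurable_quadrant_add _ (psi alpha)); exact: measurable_psi.
Qed.

Lemma measurable_Kkernel_r alpha x : 0 < x ->
  measurable_fun P (fun y : TR => Kkernel alpha x y).
Proof.
move=> x0.
apply: (@eq_measurable_fun _ _ _ _ _ (fun y : TR =>
  x `^ ((alpha - 1) / 2) * y `^ ((alpha - 1) / 2) * psi alpha (x + y))).
  by move=> y; rewrite inE RplusE => y0; rewrite KkernelE.
apply: measurable_funM; first apply: measurable_funM => //.
- by apply: measurable_funTS; exact: measurable_powR.
- apply: (@measurable_add_l (psi alpha)) => //; exact: measurable_psi.
Qed.

(** The Schur condition: the bound [psi s <= C s^(-alpha)], integrated in [y]. *)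
Lemma integral_psi_le alpha : 1 < alpha ->
  exists2 C, 0 < C & forall x, 0 < x ->
    (\int[mu]_(y in P) (psi alpha (x + y))%:E <= (C * x `^ (1 - alpha))%:E)%E.
Proof.
move=> a1; have a0 : 0 < alpha by lra.
have [C C0 hC] := psi_le_powRN a0.
exists (C / (alpha - 1)); first by rewrite divr_gt0//; lra.
move=> x x0.
have mp : measurable_fun P (fun y : TR => (x + y) `^ (- alpha)).
  apply: (@measurable_add_l (fun y => y `^ (- alpha))) => //.
  by apply: measurable_funTS; exact: measurable_powR.
apply: (@le_trans _ _ (\int[mu]_(y in P) (C%:E * ((x + y) `^ (- alpha))%:E))%E).
  apply: ge0_le_integral => //.
  - exact: measurable_Rplus.
  - move=> y; rewrite RplusE => y0.
    by rewrite lee_fin psi_ge0 ?(ltW a0)// addr_gt0.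
  - apply/measurable_EFinP; apply: (@measurable_add_l (psi alpha)) => //.
    exact: measurable_psi.
  - by apply: emeasurable_funM => //; exact/measurable_EFinP.
  - move=> y; rewrite RplusE => y0.
    by rewrite -EFinM lee_fin hC// addr_gt0.
rewrite ge0_integralZl//; first last.
- by rewrite lee_fin ltW.
- by move=> y _; rewrite lee_fin powR_ge0.
- exact/measurable_EFinP.
- exact: measurable_Rplus.
by rewrite integral_powRN// -EFinM lee_fin mulrA (mulrAC C).
Qed.

Section Bound.
Variables (alpha C : R) (F : TR -> R).
Hypotheses (a1 : 1 < alpha) (C0 : 0 < C).
Hypothesis hC : forall x, 0 < x ->
  (\int[mu]_(y in P) (psi alpha (x + y))%:E <= (C * x `^ (1 - alpha))%:E)%E.
Hypothesis mF : measurable_fun setT F.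

Let mP : measurable P := @measurable_Rplus R.
(** With [b = (alpha - 1) / 2] the integrand of [I] splits as [x^b psi^(1/2)] times
    [y^b psi^(1/2) |F y|]. The square of the second factor integrates to [B], that of the first to
    at most [C]. *)
Let I x := (\int[mu]_(y in P) `|(Kkernel alpha x y * F y)%:E|)%E.
Let B x := (\int[mu]_(y in P)
  (y `^ (alpha - 1) * psi alpha (x + y) * F y ^+ 2)%:E)%E.

Let mFP : measurable_fun P F.
Proof. exact: measurable_funTS. Qed.

Let mpow : measurable_fun P (fun y : TR => y `^ (alpha - 1)).
Proof. by apply: measurable_funTS; exact: measurable_powR. Qed.

Let mpsi x : 0 < x -> measurable_fun P (fun y : TR => psi alpha (x + y)).
Proof.
by move=> x0; apply: (@measurable_add_l (psi alpha)) => //; exact: measurable_psi.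
Qed.

Let psi0 (x y : R) : 0 < x -> 0 < y -> 0 <= psi alpha (x + y).
Proof.
move=> x0 y0; apply: psi_ge0; last exact: addr_gt0.
by rewrite (le_trans ler01)// ltW.
Qed.

Let weight0 x y : 0 < x -> 0 < y ->
  0 <= y `^ (alpha - 1) * psi alpha (x + y) * F y ^+ 2.
Proof.
move=> x0 y0; apply: mulr_ge0; last exact: sqr_ge0.
by apply: mulr_ge0; [exact: powR_ge0|exact: psi0].
Qed.

Let B_ge0 x : 0 < x -> (0 <= B x)%E.
Proof.
move=> x0; apply: integral_ge0 => y; rewrite RplusE => y0.
by rewrite lee_fin weight0.
Qed.

Let I_ge0 x : (0 <= I x)%E.
Proof. exact: integral_ge0. Qed.

(** A form of Cauchy-Schwarz with a free parameter: pointwise AM-GM is integrated, and the Schur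
    condition cancels [x^(alpha - 1)]. Stated this way it makes sense before [I] or [B] is known to
    be finite. *)
Let amgm x l : 0 < x -> 0 < l -> (2%:E * I x <= (l * C)%:E + l^-1%:E * B x)%E.
Proof.
move=> x0 l0; have lx0 : 0 <= l * x `^ (alpha - 1).
  by rewrite mulr_ge0 ?powR_ge0 ?ltW.
have mB : measurable_fun P
    (fun y : TR => y `^ (alpha - 1) * psi alpha (x + y) * F y ^+ 2).
  apply: measurable_funM; first by apply: measurable_funM => //; exact: mpsi.
  exact: measurable_funX.
rewrite /I -ge0_integralZl//; last first.
  apply: measurableT_comp => //; apply/measurable_EFinP.
  by apply: measurable_funM => //; exact: measurable_Kkernel_r.
apply: (@le_trans _ _ (\int[mu]_(y in P)
    ((l * x `^ (alpha - 1))%:E * (psi alpha (x + y))%:E +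
     l^-1%:E * (y `^ (alpha - 1) * psi alpha (x + y) * F y ^+ 2)%:E))%E).
  apply: ge0_le_integral => //.
  - apply: emeasurable_funM => //; apply: measurableT_comp => //.
    apply/measurable_EFinP; apply: measurable_funM => //.
    exact: measurable_Kkernel_r.
  - apply: emeasurable_funD; apply: emeasurable_funM => //;
      by apply/measurable_EFinP => //; exact: mpsi.
  - move=> y; rewrite RplusE => y0.
    rewrite -!EFinM -EFinD lee_fin KkernelE//.
    have e z : z `^ (alpha - 1) = (z `^ ((alpha - 1) / 2)) ^+ 2.
      by rewrite -powR_mulrn ?powR_ge0// -powRrM divfK.
    rewrite !e; have := psi0 x0 y0; have := powR_ge0 x ((alpha - 1) / 2).
    have := powR_ge0 y ((alpha - 1) / 2).
    set p := x `^ _; set q := y `^ _; set w := psi _ _ => q0 p0 w0.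
    rewrite !normrM (ger0_norm p0) (ger0_norm q0) (ger0_norm w0).
    rewrite -(real_normK (num_real (F y))); set v := `|F y|.
    (* The defect in AM-GM is an explicit square. *)
    rewrite -subr_ge0 (_ : _ - _ = w * l^-1 * (l * p - q * v) ^+ 2).
      by rewrite mulr_ge0 ?sqr_ge0// mulr_ge0// invr_ge0 ltW.
    by field; rewrite gt_eqF.
rewrite ge0_integralD//; first last.
- by apply: emeasurable_funM => //; exact/measurable_EFinP.
- move=> y; rewrite RplusE => y0; rewrite -EFinM lee_fin.
  by rewrite mulr_ge0 ?weight0// invr_ge0 ltW.
- by apply: emeasurable_funM => //; apply/measurable_EFinP; exact: mpsi.
- move=> y; rewrite RplusE => y0; rewrite -EFinM lee_fin.
  by rewrite mulr_ge0// psi0.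
rewrite !ge0_integralZl//; first last.
- by move=> y; rewrite RplusE => y0; rewrite lee_fin psi0.
- by apply/measurable_EFinP; exact: mpsi.
- by rewrite lee_fin invr_ge0 ltW.
- move=> y; rewrite RplusE => y0; rewrite lee_fin.
  exact: weight0.
- exact/measurable_EFinP.
rewrite leeD2r//.
apply: (@le_trans _ _ ((l * x `^ (alpha - 1))%:E * (C * x `^ (1 - alpha))%:E)%E).
  by apply: lee_wpmul2l => //; exact: hC.
rewrite -EFinM lee_fin -(opprB alpha 1) powRN.
by rewrite [leLHS](_ : _ = l * C)//; field; rewrite gt_eqF// powR_gt0.
Qed.

Let sqr_I_le x : 0 < x -> (I x * I x <= C%:E * B x)%E.
Proof.
move=> x0; have := B_ge0 x0; have := I_ge0 x.
have := @amgm x ^~ x0.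
case: (B x) => [b| |//] h I0 B0; last by rewrite gt0_muley ?lte_fin// leey.
(* With [B x] finite, the choice [l = 1] already bounds [I x]. *)
have : I x \is a fin_num.
  rewrite ge0_fin_numE//; have := h 1 ltr01.
  rewrite invr1 mul1e -EFinD; case: (I x) => // [r _|]; first by rewrite ltry.
  by rewrite gt0_muley ?lte_fin.
move: I0 h; case: (I x) => [r| |]// r0 h _.
rewrite -!EFinM lee_fin; rewrite lee_fin in r0, B0.
move: r0; rewrite le_eqVlt => /predU1P[<-|r0].
  by rewrite mul0r mulr_ge0// ltW.
(* The choice [l = I / C] makes [l C] equal to [I] and leaves [I <= C B / I]. *)
have := h (r / C) (divr_gt0 r0 C0).
rewrite -!EFinM -EFinD lee_fin divfK ?gt_eqF// invf_div.
move=> /(ler_wpM2r (ltW r0)).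
have : C / r * b * r = C * b by field; rewrite gt_eqF.
by lra.
Qed.

Let mweight : measurable_fun (P `*` P) (fun z : TR * TR =>
  z.2 `^ (alpha - 1) * psi alpha (z.1 + z.2) * F z.2 ^+ 2).
Proof.
apply: measurable_funM; first apply: measurable_funM.
- exact: (measurable_quadrant_snd mpow).
- by apply: (@measurable_quadrant_add _ (psi alpha)); exact: measurable_psi.
- apply: measurable_funX; exact: (measurable_quadrant_snd mFP).
Qed.

Let mB : measurable_fun P B.
Proof.
apply: (@measurable_integral_quadrant _ (fun z : TR * TR =>
  (z.2 `^ (alpha - 1) * psi alpha (z.1 + z.2) * F z.2 ^+ 2)%:E)).
- exact/measurable_EFinP.
- by move=> x y /=; rewrite !RplusE lee_fin; exact: weight0.
Qed.

(** After Tonelli the inner integral is that of [psi (x + y)] in [x]. By symmetry the same Schur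
    condition bounds it, and [y^(alpha - 1)] cancels. *)
Let integral_B_le : (\int[mu]_(x in P) B x <= C%:E * sqint F)%E.
Proof.
rewrite /B (@tonelli_quadrant _ (fun z : TR * TR =>
  (z.2 `^ (alpha - 1) * psi alpha (z.1 + z.2) * F z.2 ^+ 2)%:E)); first last.
- by move=> x y /=; rewrite !RplusE lee_fin; exact: weight0.
- exact/measurable_EFinP.
rewrite /sqint -ge0_integralZl//; first last.
- by rewrite lee_fin ltW.
- by move=> y _; rewrite lee_fin sqr_ge0.
- by apply/measurable_EFinP; exact: measurable_funX.
apply: ge0_le_integral => //.
- move=> y; rewrite RplusE => y0; apply: integral_ge0 => x; rewrite RplusE => x0.
  by rewrite lee_fin; exact: weight0.
- apply: (@measurable_integral_quadrant _ (fun z : TR * TR =>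
    (z.1 `^ (alpha - 1) * psi alpha (z.2 + z.1) * F z.1 ^+ 2)%:E)).
  + apply/measurable_EFinP; apply: measurable_funM; first apply: measurable_funM.
    * exact: (measurable_quadrant_fst mpow).
    * rewrite (_ : (fun z => _) = fun z : TR * TR => psi alpha (z.1 + z.2)).
        apply: (@measurable_quadrant_add _ (psi alpha)).
        exact: measurable_psi.
      by apply/funext => z; rewrite addrC.
    * by apply: measurable_funX; exact: (measurable_quadrant_fst mFP).
  + by move=> y x /=; rewrite !RplusE lee_fin => y0 x0; exact: weight0.
- by apply: emeasurable_funM => //; apply/measurable_EFinP; exact: measurable_funX.
move=> y; rewrite RplusE => y0 /=.
have w0 : 0 <= y `^ (alpha - 1) * F y ^+ 2.
  by rewrite mulr_ge0 ?powR_ge0 ?sqr_ge0.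
rewrite (eq_integral (fun x : TR =>
    (y `^ (alpha - 1) * F y ^+ 2)%:E * (psi alpha (y + x))%:E)%E); last first.
  by move=> x _; rewrite -EFinM (addrC x) mulrAC.
rewrite ge0_integralZl//; first last.
- by move=> x; rewrite RplusE => x0; rewrite lee_fin psi0.
- by apply/measurable_EFinP; exact: mpsi.
apply: (@le_trans _ _ ((y `^ (alpha - 1) * F y ^+ 2)%:E *
                       (C * y `^ (1 - alpha))%:E)%E).
  by apply: lee_wpmul2l => //; exact: hC.
rewrite -!EFinM lee_fin -(opprB alpha 1) powRN.
by rewrite [leLHS](_ : _ = C * F y ^+ 2)//; field; rewrite gt_eqF// powR_gt0.
Qed.

Let sqr_K_le x : 0 < x -> ((K alpha F x ^+ 2)%:E <= C%:E * B x)%E.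
Proof.
move=> x0; apply: le_trans (sqr_I_le x0).
have -> : K alpha F x = fine (\int[mu]_(y in P) (Kkernel alpha x y * F y)%:E)%E.
  by rewrite /K patchE mem_set// RplusE.
have : (`|\int[mu]_(y in P) (Kkernel alpha x y * F y)%:E| <= I x)%E.
  apply: le_abse_integral => //; apply/measurable_EFinP.
  by apply: measurable_funM => //; exact: measurable_Kkernel_r.
(* If [I x] is infinite the right-hand side is [+oo], so the default value of [fine] does no
   harm. *)
have := I_ge0 x; case: (I x) => [r| |]//; last first.
  by move=> _ _; rewrite mulyy leey.
case: (\int[mu]_(y in P) _)%E => [t| |]//=; rewrite -EFinM !lee_fin => r0 tr.
by rewrite -expr2 -(real_normK (num_real t)) ler_sqr// nnegrE.
Qed.

(** Tonelli gives measurability for nonnegative integrands only, so the integral is split into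
    positive and negative parts. *)
Lemma measurable_K : measurable_fun setT (K alpha F).
Proof.
apply/(measurable_restrictT _ mP).
have mk : measurable_fun (P `*` P)
    (fun z : TR * TR => (Kkernel alpha z.1 z.2 * F z.2)%:E).
  apply/measurable_EFinP; apply: measurable_funM.
    exact: measurable_Kkernel.
  exact: (measurable_quadrant_snd mFP).
apply: (@measurableT_comp _ _ _ _ _ _ fine); first exact: fine_measurable.
rewrite (_ : (fun x => _) = (fun x =>
  \int[mu]_(y in P) (fun z : TR * TR => (Kkernel alpha z.1 z.2 * F z.2)%:E)^\+ (x, y) -
  \int[mu]_(y in P) (fun z : TR * TR => (Kkernel alpha z.1 z.2 * F z.2)%:E)^\- (x, y))%E).
  apply: emeasurable_funB; apply: measurable_integral_quadrant => //.
  - exact: measurable_funepos.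
  - exact: measurable_funeneg.
apply/funext => x.
by rewrite integralE; congr (_ - _)%E; apply: eq_integral => y _;
  rewrite ?funeposE ?funenegE.
Qed.

(** One factor [C] comes from the row integrals, in [sqr_K_le], the other from the column integrals,
    in [integral_B_le]. *)
Lemma sqint_K_le : (sqint (K alpha F) <= (C ^+ 2)%:E * sqint F)%E.
Proof.
rewrite expr2 EFinM -muleA.
apply: (@le_trans _ _ (\int[mu]_(x in P) (C%:E * B x))%E); last first.
  rewrite ge0_integralZl//; first last.
  - by rewrite lee_fin ltW.
  - by move=> x; rewrite RplusE; exact: B_ge0.
  by apply: lee_wpmul2l; rewrite ?lee_fin ?(ltW C0).
apply: ge0_le_integral => //.
- by move=> x _; rewrite lee_fin sqr_ge0.
- apply/measurable_EFinP; apply: measurable_funX.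
  by apply: measurable_funTS; exact: measurable_K.
- exact: emeasurable_funM.
- by move=> x; rewrite RplusE; exact: sqr_K_le.
Qed.

(** [B] has a finite integral, hence is finite almost everywhere; there [I^2 <= C B] makes the row
    absolutely integrable. *)
Lemma ae_integrable_Kkernel : (sqint F < +oo)%E ->
  {ae mu_plus R, forall x, mu.-integrable P
     (fun y : TR => (Kkernel alpha x y * F y)%:E)}.
Proof.
move=> Foo; apply: ae_mu_plus.
have iB : mu.-integrable P B.
  apply/integrableP; split => //.
  rewrite (_ : (\int[mu]_(x in P) `|B x|)%E = (\int[mu]_(x in P) B x)%E).
    by apply: le_lt_trans integral_B_le _; rewrite lte_mul_pinfty// ?lee_fin ltW.
  apply: eq_integral => x /set_mem; rewrite RplusE => x0.
  by rewrite gee0_abs// B_ge0.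
apply: filterS (integrable_ae mP iB) => x Bfin Px.
move: (Bfin Px) (Px); rewrite RplusE => {}Bfin x0.
apply/integrableP; split.
  apply/measurable_EFinP.
  by apply: measurable_funM => //; exact: measurable_Kkernel_r.
have := sqr_I_le x0; rewrite /I; have := I_ge0 x; rewrite /I.
case: (\int[mu]_(y in P) _)%E => [r _ _|_|//]; first exact: ltry.
by rewrite mulyy -(fineK Bfin).
Qed.

End Bound.
End Schur.

(** * [K alpha] as a bounded operator *)

Section Boundedness.
Context (R : realType).
Notation mu := (@lebesgue_measure R).
Notation P := (Rplus R).
Notation TR := (measurableTypeR R).
Implicit Types alpha : R.

Lemma K_well_definedP alpha : 1 < alpha -> K_well_defined alpha.
Proof.
move=> a1 F /L2P[mF Foo]; have [C C0 hC] := integral_psi_le a1.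
exact: (ae_integrable_Kkernel a1 C0 hC mF Foo).
Qed.

(** Additivity of the integral needs both rows integrable, which holds only almost everywhere. *)
Lemma K_linear alpha (a : R) F G : 1 < alpha -> L2 F -> L2 G ->
  {ae mu_plus R, forall x,
     K alpha (fun y => a * F y + G y) x = a * K alpha F x + K alpha G x}.
Proof.
move=> a1 LF LG.
have := K_well_definedP a1 LG; have := K_well_definedP a1 LF.
have FF : Filter (almost_everywhere (mu_plus R)) by exact: ae_filter_ringOfSetsType.
apply: filterS2 => x iF iG; rewrite /K !patchE.
case: ifPn => _; last by rewrite mulr0 addr0.
rewrite -RintegralZl// -RintegralD//; last first.
  rewrite (_ : EFin \o _ = (fun y : TR => a%:E * (Kkernel alpha x y * F y)%:E)%E).
    exact: integrableZl.
  by apply/funext => y /=; rewrite EFinM.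
by apply: eq_Rintegral => y _; rewrite mulrDr mulrCA.
Qed.

Lemma bounded_operator_K alpha : 1 < alpha -> bounded_operator (K alpha).
Proof.
move=> a1; have [C C0 hC] := integral_psi_le a1; split.
- move=> F /L2P[mF Foo]; apply/L2P; split; first exact: measurable_K.
  apply: le_lt_trans (sqint_K_le a1 C0 hC mF) _.
  by rewrite lte_mul_pinfty// ?lee_fin ?sqr_ge0// lte_mul_pinfty.
- by move=> a F G; exact: K_linear.
- exists C => F /L2P[mF Foo].
  rewrite !L2normE//; last exact: measurable_K.
  apply: (@le_trans _ _ (((C ^+ 2)%:E * sqint F) `^ 2^-1)%E).
    apply: gt0_ler_poweR; rewrite ?invr_ge0// ?in_itv/= ?leey ?sqint_ge0//.
    - by rewrite mule_ge0 ?sqint_ge0// lee_fin sqr_ge0.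
    - exact: (sqint_K_le a1 C0 hC mF).
  rewrite poweRM ?sqint_ge0 ?lee_fin ?sqr_ge0// poweR_EFin powR12_sqrt ?sqr_ge0//.
  by rewrite sqrtr_sqr ger0_norm// ltW.
Qed.

End Boundedness.

(** * Elementary exponential integrals and the value of [Lambda 2] *)

Section LaplaceIntegrals.
Context (R : realType).
Notation mu := (@lebesgue_measure R).
Notation P := (Rplus R).
Notation TR := (measurableTypeR R).
Implicit Types b c s x y t : R.

(** Removes the boundary terms at infinity of the antiderivatives below. Bounding the exponential by
    a multiple of [y^(-2)] leaves [M / y] for [y >= 1]. *)
Lemma cvgy_affine_expRN b c d : 0 < c ->
  (b * y + d) * expR (- (c * y)) @[y --> +oo] --> (0 : R).
Proof.
move=> c0.
pose M := (`|b| + `|d|) * (c / 2) `^ (- 2).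
have M0 : 0 <= M by rewrite mulr_ge0 ?powR_ge0 ?addr_ge0.
have h : M * y `^ (- 1) @[y --> +oo] --> (0 : R).
  by rewrite -[X in _ --> X](mulr0 M); apply: cvgMr; exact: cvgy_powRN.
have h' : - (M * y `^ (- 1)) @[y --> +oo] --> (0 : R).
  by rewrite -[X in _ --> X]oppr0; exact: cvgN.
apply: (squeeze_cvgr _ h' h).
near=> y; have y1 : 1 <= y by near: y; exact: (nbhs_pinfty_ge (num_real _)).
have y0 : 0 < y by lra.
rewrite -ler_norml normrM (ger0_norm (expR_ge0 _)).
apply: (@le_trans _ _ ((`|b| + `|d|) * y * ((c / 2) `^ (- 2) * y `^ (- 2)))).
  apply: ler_pM; [exact: normr_ge0|exact: expR_ge0| |by apply: expRN_le_powRN].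
  apply: le_trans (ler_normD _ _) _; rewrite normrM (gtr0_norm y0) mulrDl lerD2l.
  by rewrite ler_peMr.
rewrite (_ : y `^ (- 2) = y `^ (-1) * y^-1).
  by rewrite [leLHS](_ : _ = M * y `^ (-1))// /M; field; rewrite gt_eqF.
by rewrite -(powR_inv1 (ltW y0)) -powRD ?(gt_eqF y0) ?implybT//; congr (_ `^ _); ring.
Unshelve. all: by end_near. Qed.

Lemma is_derive_expRN c y : is_derive y 1 (fun z : R => expR (- (c * z)))
  (- c * expR (- (c * y))).
Proof.
have -> : (fun z : R => expR (- (c * z))) = expR \o (cst (- c) * @id R).
  by apply/funext => z /=; rewrite mulNr.
have h : is_derive y 1 (cst (- c) * @id R) (- c).
  by apply: is_derive_eq; rewrite /GRing.scale/= mulr0 addr0 mulr1.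
have := is_derive_expR ((cst (- c) * @id R) y) => h2.
apply: (is_derive_eq (is_derive1_comp h2 h)).
by rewrite mulrC -[in RHS](mulNr c y).
Qed.

Lemma measurable_expRN c : measurable_fun P (fun y : TR => expR (- (c * y))).
Proof.
apply: measurable_funTS; apply: (@measurableT_comp _ _ _ _ _ _ (@expR R)).
  exact: measurable_expR.
by apply: measurable_funN; exact: measurable_funM.
Qed.

Lemma measurable_exprVn b n : 0 <= b -> measurable_fun P (fun t : TR => (b + t) ^- n).
Proof.
move=> b0; apply: (@eq_measurable_fun _ _ _ _ _ (fun t => (b + t) `^ (- n%:R))).
  move=> t /set_mem; rewrite RplusE => t0.
  by rewrite powR_invn// addr_ge0// ltW.
apply: measurable_funTS.
apply: (@measurableT_comp _ _ _ _ _ _ (fun t : R => t `^ (- n%:R))).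
  exact: measurable_powR.
exact: measurable_funD.
Qed.

Lemma integral_expRN c : 0 < c ->
  (\int[mu]_(y in P) (expR (- (c * y)))%:E)%E = c^-1%:E.
Proof.
move=> c0; have cn0 : c != 0 by rewrite gt_eqF.
pose F y := - c^-1 * expR (- (c * y)).
have dF y : 0 <= y -> is_derive y 1 F (expR (- (c * y))).
  move=> _; have h := is_derive_expRN c y.
  have -> : F = cst (- c^-1) * (fun z : R => expR (- (c * z))) by [].
  apply: is_derive_eq; rewrite /GRing.scale/= mulr0 addr0.
  by rewrite mulrA mulrNN mulVf ?mul1r.
have Fy : F y @[y --> +oo] --> 0.
  have := @cvgy_affine_expRN 0 c (- c^-1) c0.
  by under eq_fun do rewrite mul0r add0r.
have cf y : 0 <= y -> {for y, continuous (fun y => expR (- (c * y)))}.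
  by move=> _; exact: is_derive_continuous (is_derive_expRN c y).
have f0 y : 0 <= y -> 0 <= expR (- (c * y)) by move=> _; exact: expR_ge0.
by rewrite (integral_oy_FTC f0 cf dF Fy) /F mulr0 oppr0 expR0 mulr1 opprK.
Qed.

Lemma integral_id_expRN c : 0 < c ->
  (\int[mu]_(y in P) (y * expR (- (c * y)))%:E)%E = (c ^- 2)%:E.
Proof.
move=> c0; have cn0 : c != 0 by rewrite gt_eqF.
pose F y := (- c^-1 * y + - c ^- 2) * expR (- (c * y)).
have dF y : 0 <= y -> is_derive y 1 F (y * expR (- (c * y))).
  move=> _; have h := is_derive_expRN c y.
  have -> : F = (cst (- c^-1) * @id R + cst (- c ^- 2)) *
                (fun z : R => expR (- (c * z))) by [].
  apply: is_derive_eq; rewrite /GRing.scale/= !fctE.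
  by move: (expR _) => e; field; exact: cn0.
have Fy : F y @[y --> +oo] --> 0 by exact: cvgy_affine_expRN.
have cf y : 0 <= y -> {for y, continuous (fun y => y * expR (- (c * y)))}.
  move=> _; have h := is_derive_expRN c y.
  have /is_derive_continuous// := is_deriveM (is_derive_id y 1) h.
have f0 y : 0 <= y -> 0 <= y * expR (- (c * y)).
  by move=> y0; rewrite mulr_ge0 ?expR_ge0.
by rewrite (integral_oy_FTC f0 cf dF Fy) /F !mulr0 add0r oppr0 expR0 mulr1 opprK.
Qed.

Lemma Lambda2 : Lambda (2 : R) = 1.
Proof.
have G1 : Gamma (2 / 2 : R) = 1.
  rewrite /Gamma /Rintegral.
  rewrite (eq_integral (fun t : TR => (expR (- (1 * t)))%:E)); last first.
    by move=> t _; rewrite divff// subrr powRr0 !mul1r.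
  by rewrite integral_expRN// invr1.
have G2 : Gamma (2 : R) = 1.
  rewrite /Gamma /Rintegral.
  rewrite (eq_integral (fun t : TR => (t * expR (- (1 * t)))%:E)); last first.
    move=> t; rewrite inE/= in_itv/= andbT => t0.
    by rewrite (_ : 2 - 1 = 1) ?powRr1 ?mul1r ?ltW//; ring.
  by rewrite integral_id_expRN// expr1n invr1.
by rewrite /Lambda G1 G2 expr1n divr1.
Qed.

End LaplaceIntegrals.

(** * The quadratic form as a double integral *)

Section DoubleIntegral.
Context (R : realType).
Notation mu := (@lebesgue_measure R).
Notation P := (Rplus R).
Notation TR := (measurableTypeR R).
Implicit Types (b c s x y t : R) (h : TR -> R).

(** The form [<K_2 F, F>] for the test vector, up to [(2 a)^2]: the weight [x y] collects the square
    roots of [F] and of the kernel. Along [x + y = s] it integrates to [s^3 / 6], which explains the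
    values found below. *)
Definition dint h : \bar R :=
  (\int[mu]_(x in P) \int[mu]_(y in P) (x * y * h (x + y))%:E)%E.

Let mP : measurable P := @measurable_Rplus R.

Let mid : measurable_fun P (@id TR).
Proof. exact: measurable_id. Qed.

Let mdint_r h x : 0 < x -> measurable_fun P h ->
  measurable_fun P (fun y : TR => (x * y * h (x + y))%:E).
Proof.
move=> x0 mh; apply/measurable_EFinP; apply: measurable_funM.
  exact: measurable_funM.
exact: measurable_add_l.
Qed.

Let dint_ge0 h x y : (forall s, 0 < s -> 0 <= h s) -> 0 < x -> 0 < y ->
  0 <= x * y * h (x + y).
Proof.
move=> h0 x0 y0; apply: mulr_ge0; first by rewrite mulr_ge0 ?ltW.
by apply: h0; rewrite addr_gt0.
Qed.

Let mdint h : (forall s, 0 < s -> 0 <= h s) -> measurable_fun P h ->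
  measurable_fun P (fun x => \int[mu]_(y in P) (x * y * h (x + y))%:E)%E.
Proof.
move=> h0 mh; apply: (@measurable_integral_quadrant _ (fun z : TR * TR =>
  (z.1 * z.2 * h (z.1 + z.2))%:E)).
- apply/measurable_EFinP; apply: measurable_funM; first apply: measurable_funM.
  + exact: (measurable_quadrant_fst mid).
  + exact: (measurable_quadrant_snd mid).
  + exact: measurable_quadrant_add.
- by move=> x y; rewrite !RplusE lee_fin; exact: dint_ge0.
Qed.

Let dint_in_ge0 h x : (forall s, 0 < s -> 0 <= h s) -> P x ->
  (0 <= \int[mu]_(y in P) (x * y * h (x + y))%:E)%E.
Proof.
move=> h0; rewrite RplusE => x0; apply: integral_ge0 => y; rewrite RplusE => y0.
by rewrite lee_fin dint_ge0.
Qed.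

Lemma le_dint h1 h2 : measurable_fun P h1 -> measurable_fun P h2 ->
  (forall s, 0 < s -> 0 <= h1 s) -> (forall s, 0 < s -> h1 s <= h2 s) ->
  (dint h1 <= dint h2)%E.
Proof.
move=> m1 m2 h10 h12.
have h20 s : 0 < s -> 0 <= h2 s.
  by move=> s0; apply: le_trans (h12 s s0); exact: h10.
apply: ge0_le_integral => //.
- by move=> x; exact: dint_in_ge0.
- exact: mdint.
- exact: mdint.
move=> x; rewrite RplusE => x0; apply: ge0_le_integral => //.
- by move=> y; rewrite RplusE => y0; rewrite lee_fin dint_ge0.
- exact: mdint_r.
- exact: mdint_r.
move=> y; rewrite RplusE => y0; rewrite lee_fin ler_wpM2l ?h12 ?addr_gt0//.
by rewrite mulr_ge0 ?ltW.
Qed.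

(** Scaling and addition in one step, so that a sum of scaled terms unfolds by rewriting; [h2 = 0]
    gives pure scaling. *)
Lemma dintZD c h1 h2 : 0 <= c ->
  measurable_fun P h1 -> measurable_fun P h2 ->
  (forall s, 0 < s -> 0 <= h1 s) -> (forall s, 0 < s -> 0 <= h2 s) ->
  dint (fun s => c * h1 s + h2 s) = (c%:E * dint h1 + dint h2)%E.
Proof.
move=> c0 m1 m2 h10 h20.
rewrite /dint -ge0_integralZl//; first last.
- by move=> x; exact: dint_in_ge0.
- exact: mdint.
rewrite -ge0_integralD//; first last.
- exact: mdint.
- by move=> x; exact: dint_in_ge0.
- by apply: emeasurable_funM => //; exact: mdint.
- by move=> x Px; rewrite mule_ge0 ?lee_fin// dint_in_ge0.
apply: eq_integral => x /set_mem; rewrite RplusE => x0.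
rewrite -ge0_integralZl//; first last.
- by move=> y; rewrite RplusE => y0; rewrite lee_fin dint_ge0.
- exact: mdint_r.
rewrite -ge0_integralD//; first last.
- exact: mdint_r.
- by move=> y; rewrite RplusE => y0; rewrite lee_fin dint_ge0.
- by apply: emeasurable_funM => //; exact: mdint_r.
- by move=> y; rewrite RplusE => y0; rewrite mule_ge0 ?lee_fin// dint_ge0.
apply: eq_integral => y _; rewrite -EFinM -EFinD; congr EFin; ring.
Qed.

Lemma dint0 : dint (fun=> 0 : R) = 0%E.
Proof.
rewrite /dint integral0_eq// => x _; apply: integral0_eq => y _.
by rewrite mulr0.
Qed.

Let mexp := @measurable_expRN R.

(** The integrand factors, so the result is the square of the integral of [x e^(-b x)]. *)
Lemma dint_expRN b : 0 < b -> dint (fun s => expR (- (b * s))) = (b ^- 4)%:E.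
Proof.
move=> b0; rewrite /dint.
have mxe : measurable_fun P (fun y : TR => (y * expR (- (b * y)))%:E).
  by apply/measurable_EFinP; exact: measurable_funM.
have xe0 y : P y -> (0 <= (y * expR (- (b * y)))%:E)%E.
  by rewrite RplusE => y0; rewrite lee_fin mulr_ge0 ?expR_ge0 ?ltW.
rewrite (eq_integral (fun x : TR =>
    (b ^- 2)%:E * (x * expR (- (b * x)))%:E)%E); last first.
  move=> x /set_mem; rewrite RplusE => x0.
  rewrite -(integral_id_expRN b0) muleC -ge0_integralZl//.
    by apply: eq_integral => y _; rewrite -EFinM mulrDr opprD expRD; congr EFin; ring.
  by rewrite lee_fin mulr_ge0 ?expR_ge0 ?ltW.
rewrite ge0_integralZl//; last by rewrite lee_fin invr_ge0 sqr_ge0.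
by rewrite integral_id_expRN// -EFinM -invfM -exprD.
Qed.

(** If [h] is a superposition of exponentials [e^(-(b+t)s)] with density [rho], then Tonelli moves
    [t] outside, and each exponential contributes [(b+t)^(-4)]. *)
Lemma dint_laplace b (rho h : TR -> R) : 0 < b -> measurable_fun P rho ->
  (forall t, 0 < t -> 0 <= rho t) ->
  (forall s, 0 < s ->
     (h s)%:E = (\int[mu]_(t in P) (rho t * expR (- ((b + t) * s)))%:E)%E) ->
  dint h = (\int[mu]_(t in P) (rho t * (b + t) ^- 4)%:E)%E.
Proof.
move=> b0 mrho rho0 hE; rewrite /dint.
have mq1 : measurable_fun (P `*` P) (fun z : TR * TR => z.1).
  exact: (measurable_quadrant_fst mid).
have mq2 : measurable_fun (P `*` P) (fun z : TR * TR => z.2).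
  exact: (measurable_quadrant_snd mid).
have mr2 : measurable_fun (P `*` P) (fun z : TR * TR => rho z.2).
  exact: (measurable_quadrant_snd mrho).
have mex x : measurable_fun (P `*` P)
    (fun z : TR * TR => expR (- ((b + z.2) * (x + z.1)))).
  apply: (@measurableT_comp _ _ _ _ _ _ (@expR R)); first exact: measurable_expR.
  by apply: measurable_funN; apply: measurable_funM; exact: measurable_funD.
have bt0 t : 0 < t -> 0 < b + t by move=> t0; rewrite addr_gt0.
(* First exchange, of [y] and [t]; integrating over [y] yields the first [(b+t)^(-2)]. *)
have inner x : 0 < x -> (\int[mu]_(y in P) (x * y * h (x + y))%:E =
    \int[mu]_(t in P) (x * rho t * expR (- ((b + t) * x)) * (b + t) ^- 2)%:E)%E.
  move=> x0.
  pose g (z : TR * TR) :=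
    (x * z.1 * (rho z.2 * expR (- ((b + z.2) * (x + z.1)))))%:E.
  transitivity (\int[mu]_(y in P) \int[mu]_(t in P) g (y, t))%E.
    apply: eq_integral => y /set_mem; rewrite RplusE => y0.
    rewrite EFinM hE ?addr_gt0// -ge0_integralZl//.
    - apply/measurable_EFinP; apply: measurable_funM => //.
      apply: (@measurableT_comp _ _ _ _ _ _ (@expR R)).
        exact: measurable_expR.
      by apply: measurable_funN; apply: measurable_funM => //; exact: measurable_funD.
    - by move=> t; rewrite RplusE => t0; rewrite lee_fin mulr_ge0 ?expR_ge0 ?rho0.
    - by rewrite lee_fin mulr_ge0 ?ltW.
  rewrite tonelli_quadrant; first last.
  - move=> y t; rewrite !RplusE => y0 t0.
    by rewrite lee_fin mulr_ge0// ?mulr_ge0 ?expR_ge0 ?rho0 ?ltW.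
  - apply/measurable_EFinP; apply: measurable_funM; apply: measurable_funM => //.
  apply: eq_integral => t /set_mem; rewrite RplusE => t0 /=.
  rewrite [RHS]EFinM -integral_id_expRN ?bt0// -ge0_integralZl//.
  - apply: eq_integral => y _; rewrite /g/= -EFinM mulrDr opprD expRD; congr EFin; ring.
  - by apply/measurable_EFinP; exact: measurable_funM.
  - by move=> y; rewrite RplusE => y0; rewrite lee_fin mulr_ge0 ?expR_ge0 ?ltW.
  - by rewrite lee_fin mulr_ge0 ?expR_ge0// mulr_ge0 ?rho0 ?ltW.
(* Second exchange, of [x] and [t]; integrating over [x] yields the other [(b+t)^(-2)]. *)
pose g (z : TR * TR) :=
  (z.1 * rho z.2 * expR (- ((b + z.2) * z.1)) * (b + z.2) ^- 2)%:E.
transitivity (\int[mu]_(x in P) \int[mu]_(t in P) g (x, t))%E.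
  by apply: eq_integral => x /set_mem; rewrite RplusE => x0; exact: inner.
rewrite tonelli_quadrant; first last.
- move=> x t; rewrite !RplusE => x0 t0 /=.
  rewrite lee_fin mulr_ge0 ?invr_ge0 ?sqr_ge0//.
  by rewrite mulr_ge0 ?expR_ge0// mulr_ge0 ?rho0 ?ltW.
- apply/measurable_EFinP; apply: measurable_funM.
    apply: measurable_funM; first exact: measurable_funM.
    by have := mex 0; under eq_fun do rewrite add0r.
  exact: (measurable_quadrant_snd (measurable_exprVn 2 (ltW b0))).
apply: eq_integral => t /set_mem; rewrite RplusE => t0 /=.
rewrite (_ : rho t * _ = rho t * (b + t) ^- 2 * (b + t) ^- 2); last first.
  by field; rewrite gt_eqF// bt0.
rewrite [RHS]EFinM -[X in (_ * X)%E]integral_id_expRN ?bt0// -ge0_integralZl//.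
- apply: eq_integral => y _; rewrite /g/= -EFinM; congr EFin; ring.
- by apply/measurable_EFinP; exact: measurable_funM.
- by move=> y; rewrite RplusE => y0; rewrite lee_fin mulr_ge0 ?expR_ge0 ?ltW.
- by rewrite lee_fin mulr_ge0 ?rho0 ?invr_ge0 ?sqr_ge0.
Qed.

End DoubleIntegral.

(** * Closed forms for the double integrals, and a bound for [ln 2] *)

Section ExplicitDoubleIntegrals.
Context (R : realType).
Notation mu := (@lebesgue_measure R).
Notation P := (Rplus R).
Notation TR := (measurableTypeR R).
Implicit Types b s t : R.

Let mP : measurable P := @measurable_Rplus R.

Let mexp := @measurable_expRN R.

Lemma integral_exprVn b n : 0 < b ->
  (\int[mu]_(t in P) ((b + t) ^- n.+2)%:E)%E = (b ^- n.+1 / n.+1%:R)%:E.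
Proof.
move=> b0.
rewrite (eq_integral (fun t : TR => ((b + t) `^ (- n.+2%:R))%:E)); last first.
  move=> t /set_mem; rewrite RplusE => t0.
  by rewrite powR_invn// addr_ge0// ltW.
have -> := integral_powRN b0 (_ : 1 < n.+2%:R); last by rewrite ltr1n.
rewrite (_ : n.+2%:R - 1 = n.+1%:R); last by rewrite -natr1 addrK.
rewrite (_ : 1 - n.+2%:R = - n.+1%:R); last by rewrite -natr1 opprD addrCA subrr addr0.
by rewrite powR_invn// ltW.
Qed.

(** Density 1: [1/s] is the integral of [e^(-t s)] over [t > 0]. *)
Lemma dint_expRN_div b : 0 < b ->
  dint (fun s => expR (- (b * s)) / s) = (b ^- 3 / 3)%:E.
Proof.
move=> b0; rewrite (@dint_laplace _ b (cst 1))//.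
  by rewrite -integral_exprVn//; apply: eq_integral => t _ /=; rewrite mul1r.
move=> s s0; rewrite EFinM -integral_expRN// -ge0_integralZl//.
- apply: eq_integral => t _ /=.
  by rewrite -EFinM mul1r -expRD; congr (expR _)%:E; ring.
- exact/measurable_EFinP.
Qed.

(** Writing [t = (b + t) - b] reduces to pure powers. The identity is first stated as a sum, which
    avoids subtraction of extended reals. *)
Lemma integral_id_exprV4 b : 0 < b ->
  (\int[mu]_(t in P) (t * (b + t) ^- 4)%:E)%E = (b ^- 2 / 6)%:E.
Proof.
move=> b0; have bn0 : b != 0 by rewrite gt_eqF.
have bt0 t : 0 < t -> 0 < b + t by move=> t0; rewrite addr_gt0.
have bV0 t n : P t -> 0 <= (b + t) ^- n.
  by rewrite RplusE => t0; rewrite invr_ge0 exprn_ge0// ltW// bt0.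
have mV := measurable_exprVn 4 (ltW b0).
have : (\int[mu]_(t in P) (t * (b + t) ^- 4)%:E + b%:E * (b ^- 3 / 3)%:E =
        (b ^- 2 / 2)%:E)%E.
  rewrite -!integral_exprVn// -ge0_integralZl//; first last.
  - by rewrite lee_fin ltW.
  - by move=> t Pt; rewrite lee_fin bV0.
  - exact/measurable_EFinP.
  rewrite -ge0_integralD//; first last.
  - by apply: emeasurable_funM => //; exact/measurable_EFinP.
  - by move=> t Pt; rewrite mule_ge0 ?lee_fin ?bV0// ltW.
  - by apply/measurable_EFinP; exact: measurable_funM.
  - move=> t Pt; rewrite lee_fin mulr_ge0 ?bV0//.
    by move: Pt; rewrite RplusE => /ltW.
  apply: eq_integral => t /set_mem; rewrite RplusE => t0.
  rewrite -EFinM -EFinD; congr EFin; field; exact: lt0r_neq0 (bt0 _ t0).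
rewrite -EFinM; case: (\int[mu]_(t in P) _)%E => // r [].
move=> h; congr EFin; apply: (addIr (b * (b ^- 3 / 3))); rewrite h.
by field.
Qed.

(** Density [t]: [1/s^2] is the integral of [t e^(-t s)]. *)
Lemma dint_expRN_div2 b : 0 < b ->
  dint (fun s => expR (- (b * s)) / s ^+ 2) = (b ^- 2 / 6)%:E.
Proof.
move=> b0; rewrite (@dint_laplace _ b id)//.
- exact: integral_id_exprV4.
- by move=> t /ltW.
move=> s s0; rewrite EFinM -integral_id_expRN// -ge0_integralZl//.
- apply: eq_integral => t _ /=.
  rewrite -EFinM mulrCA -expRD; congr (_ * expR _)%:E; ring.
- by apply/measurable_EFinP; exact: measurable_funM.
- move=> t; rewrite RplusE => t0.
  by rewrite lee_fin mulr_ge0 ?expR_ge0// ltW.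
Qed.

Lemma ln2_le : ln 2 <= 7 / 10 :> R.
Proof.
have dbl (y c d : R) : 0 <= c -> d <= c * c -> c <= expR (y / 2) -> d <= expR y.
  move=> c0 dc cy; apply: le_trans dc _.
  by rewrite [in leRHS](splitr y) expRD; exact: ler_pM.
rewrite -[leRHS](@expRK R) ler_ln ?posrE ?expR_gt0//.
(* Rational lower bounds for [expR (7 / (10 * 2 ^ k))], rounded down at each
   squaring, from [k = 1] to [k = 6]. *)
apply: (dbl _ (58 / 41)); [lra|lra|].
apply: (dbl _ (157 / 132)); [lra|lra|].
apply: (dbl _ (325 / 298)); [lra|lra|].
apply: (dbl _ (306 / 293)); [lra|lra|].
apply: (dbl _ (93 / 91)); [lra|lra|].
apply: (dbl _ (1 + 7 / 640)); [lra|lra|].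
by apply: le_trans (expR_ge1Dx _); lra.
Qed.

End ExplicitDoubleIntegrals.

(** * The explicit minorant of [e^(-a s) psi 2 s] and its value *)

Section Minorant.
Context (R : realType).
Notation P := (Rplus R).
Notation TR := (measurableTypeR R).
Implicit Types s x y : R.

Let mP : measurable P := @measurable_Rplus R.
(** A round value near the maximiser of the lower bound [(2 a)^2 val] below. [A] and [B] are the
    decay rates of [e^(-a s) 2^(-s)] and [e^(-a s) 4^(-s)]. *)
Let a : R := 8 / 5.
Let A : R := a + ln 2.
Let B : R := a + 2 * ln 2.

Let a0 : 0 < a.
Proof. by rewrite /a; lra. Qed.

Let ln20 : 0 < ln (2 : R).
Proof. by rewrite ln_gt0// ltr1n. Qed.

Let A0 : 0 < A.
Proof. by rewrite addr_gt0. Qed.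

Let B0 : 0 < B.
Proof. by rewrite addr_gt0// mulr_gt0. Qed.

Let mexp := @measurable_expRN R.

Let mexpV (c : R) n : measurable_fun P (fun y : TR => expR (- (c * y)) / y ^+ n).
Proof.
apply: measurable_funM; first exact: measurable_expRN.
by have := measurable_exprVn n (lexx (0 : R)); under eq_fun do rewrite add0r.
Qed.

Let expV0 (c : R) n s : 0 < s -> 0 <= expR (- (c * s)) / s ^+ n.
Proof. by move=> s0; rewrite divr_ge0 ?expR_ge0// exprn_ge0// ltW. Qed.

Let good (h : TR -> R) := measurable_fun P h /\ forall s, 0 < s -> 0 <= h s.

Let term (b : R) n (s : TR) : R := expR (- (b * s)) / s ^+ n.

Let add_term (c b : R) n (h : TR -> R) := fun s => c * term b n s + h s.

Let good0 : good (fun=> 0).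
Proof. by split. Qed.

Let good_add c b n h : 0 <= c -> good h -> good (add_term c b n h).
Proof.
move=> c0 [mh h0]; split.
  by apply: measurable_funD => //; apply: measurable_funM => //; exact: mexpV.
by move=> s s0; rewrite addr_ge0 ?h0// mulr_ge0// expV0.
Qed.

Let dint_add c b n h : 0 <= c -> good h ->
  dint (add_term c b n h) = (c%:E * dint (term b n) + dint h)%E.
Proof.
by move=> c0 [mh h0]; apply: dintZD => // [|s]; [exact: mexpV|exact: expV0].
Qed.

(** The expansion of [e^(-a s) ((1 + q (1/s + 1/4))^2 - 1)] with [q = 2^(-s)]: rate [A] carries
    [2/s + 1/2], rate [B] carries [1/s^2 + 1/(2 s) + 1/16]. *)
Let minor5 := add_term 16^-1 B 0 (fun=> 0).
Let minor4 := add_term 2^-1 B 1 minor5.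
Let minor3 := add_term 1 B 2 minor4.
Let minor2 := add_term 2^-1 A 0 minor3.
Let minor := add_term 2 A 1 minor2.

Let good5 : good minor5. Proof. exact: good_add. Qed.
Let good4 : good minor4. Proof. exact: good_add. Qed.
Let good3 : good minor3. Proof. exact: good_add. Qed.
Let good2 : good minor2. Proof. exact: good_add. Qed.
Let good1 : good minor. Proof. exact: good_add. Qed.

Let mmajor : measurable_fun P (fun s : TR => expR (- (a * s)) * psi 2 s).
Proof.
by apply: measurable_funM; [exact: measurable_expRN|exact: measurable_psi].
Qed.

Let minor_le s : 0 < s -> minor s <= expR (- (a * s)) * psi 2 s.
Proof.
move=> s0; rewrite /psi powR_mulrn; last first.
  by rewrite (le_trans ler01)// ltW// zeta_gt1.
have := zeta_ge s0; set z := zeta _; set q := 2 `^ (- s) => zq.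
have q0 : 0 < q by rewrite powR_gt0.
have v0 : 0 < s^-1 by rewrite invr_gt0.
have eA : expR (- (A * s)) = expR (- (a * s)) * q.
  by rewrite /q powR_expR// -expRD; congr expR; rewrite /A; ring.
have eB : expR (- (B * s)) = expR (- (a * s)) * q ^+ 2.
  by rewrite /q powR_expR// expr2 -!expRD; congr expR; rewrite /B; ring.
pose w := 1 + q * (s^-1 + 4^-1).
have w0 : 0 <= w by rewrite /w addr_ge0// mulr_ge0 ?(ltW q0)// addr_ge0 ?(ltW v0).
have -> : minor s = expR (- (a * s)) * (w ^+ 2 - 1).
  rewrite /minor /minor2 /minor3 /minor4 /minor5 /add_term /term eA eB /w.
  by move: (expR _) => e; field; exact: lt0r_neq0.
rewrite ler_wpM2l ?expR_ge0// lerD2r ler_sqr// nnegrE.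
exact: le_trans zq.
Qed.

Let val : R := 2 * (A ^- 3 / 3) + (2^-1 * A ^- 4 + (1 * (B ^- 2 / 6) +
  (2^-1 * (B ^- 3 / 3) + (16^-1 * B ^- 4 + 0)))).

Let dint_minor : dint minor = val%:E.
Proof.
have d0 b : 0 < b -> dint (term b 0) = (b ^- 4)%:E.
  move=> b0; rewrite -dint_expRN//; congr dint.
  by apply/funext => s; rewrite /term divr1.
have d1 b : 0 < b -> dint (term b 1) = (b ^- 3 / 3)%:E.
  by move=> b0; rewrite -dint_expRN_div.
have d2 b : 0 < b -> dint (term b 2) = (b ^- 2 / 6)%:E.
  by move=> b0; rewrite -dint_expRN_div2.
rewrite dint_add// dint_add// dint_add// dint_add// dint_add//.
by rewrite !d0// !d1// d2// dint0 -!EFinM -!EFinD.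
Qed.

Let val_gt : 1 < (2 * a) ^+ 2 * val.
Proof.
have l2 := ln2_le R.
(* From [ln 2 <= 7/10]: [A <= 8/5 + 7/10 = 23/10] and [B <= 8/5 + 14/10 = 3]. Since [val] is
   increasing in [1/A] and [1/B], rational arithmetic remains. *)
have hA : 10 / 23 <= A^-1.
  by rewrite -[leLHS]invrK lef_pV2 ?posrE// /A /a; lra.
have hB : 3^-1 <= B^-1 by rewrite lef_pV2 ?posrE// /B /a; lra.
rewrite /val -!exprVn; move: hA hB; set u := A^-1; set v := B^-1 => hA hB.
have pw (x c : R) n : 0 <= c -> c <= x -> c ^+ n <= x ^+ n.
  by move=> c0 cx; rewrite lerXn2r// nnegrE (le_trans c0).
have c0 : 0 <= 10 / 23 :> R by lra.
have d0 : 0 <= 3^-1 :> R by lra.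
have := (pw _ _ 3 c0 hA, pw _ _ 4 c0 hA).
have := (pw _ _ 2 d0 hB, pw _ _ 3 d0 hB, pw _ _ 4 d0 hB).
by move=> [[hB2 hB3] hB4] [hA3 hA4]; rewrite /a; lra.
Qed.

Lemma dint_psi2_gt :
  (1 < ((2 * (8 / 5)) ^+ 2)%:E *
       dint (fun s : R => expR (- (8 / 5 * s)) * psi 2 s)%R)%E.
Proof.
apply: (@lt_le_trans _ _ (((2 * a) ^+ 2)%:E * val%:E)%E).
  by rewrite -EFinM lte_fin.
apply: lee_wpmul2l; first by rewrite lee_fin sqr_ge0.
rewrite -dint_minor; apply: le_dint.
- exact: good1.1.
- exact: mmajor.
- exact: good1.2.
- exact: minor_le.
Qed.

End Minorant.

(** * The test vector and the strict lower bound for the norm *)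

Section TestFunction.
Context (R : realType).
Notation mu := (@lebesgue_measure R).
Notation P := (Rplus R).
Notation TR := (measurableTypeR R).
Implicit Types s x y : R.

Let mP : measurable P := @measurable_Rplus R.
Let a : R := 8 / 5.

Let a0 : 0 < a.
Proof. by rewrite /a; lra. Qed.

Let mexp := @measurable_expRN R.

Let mmajor : measurable_fun P (fun s : TR => expR (- (a * s)) * psi 2 s).
Proof.
by apply: measurable_funM; [exact: measurable_expRN|exact: measurable_psi].
Qed.

(** The exponent [1/2], left unreduced to match the one in [KkernelE] at [alpha = 2]. *)
Let beta : R := (2 - 1) / 2.
(** The factor [2 a] normalises: [x e^(-2 a x)] has integral [(2 a)^(-2)]. *)
Let F (x : TR) : R := 2 * a * (x `^ beta * expR (- (a * x))).

Let mF : measurable_fun setT F.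
Proof.
apply: measurable_funM => //; apply: measurable_funM; first exact: measurable_powR.
apply: (@measurableT_comp _ _ _ _ _ _ (@expR R)); first exact: measurable_expR.
by apply: measurable_funN; exact: measurable_funM.
Qed.

Let powR_betaM x : 0 < x -> x `^ beta * x `^ beta = x.
Proof.
move=> x0; rewrite -powRD ?(gt_eqF x0) ?implybT//.
by rewrite (_ : beta + beta = 1) ?powRr1 ?ltW// /beta; lra.
Qed.

Let F_ge0 x : 0 <= F x.
Proof.
apply: mulr_ge0; first by rewrite mulr_ge0// ltW.
by rewrite mulr_ge0 ?powR_ge0 ?expR_ge0.
Qed.

Let sqint_F : sqint F = 1%:E.
Proof.
rewrite /sqint (eq_integral (fun x : TR =>
    ((2 * a) ^+ 2)%:E * (x * expR (- ((2 * a) * x)))%:E)%E); last first.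
  move=> x /set_mem; rewrite RplusE => x0; rewrite -EFinM /F; congr EFin.
  have -> : - (2 * a * x) = - (a * x) + - (a * x) by ring.
  have := powR_betaM x0; rewrite expRD; move: (x `^ beta) (expR _) => p e <-.
  by ring.
have a20 : 0 < 2 * a by rewrite mulr_gt0.
rewrite ge0_integralZl//; first last.
- by rewrite lee_fin sqr_ge0.
- by move=> x; rewrite RplusE => x0; rewrite lee_fin mulr_ge0 ?expR_ge0 ?ltW.
- by apply/measurable_EFinP; exact: measurable_funM.
by rewrite integral_id_expRN// -EFinM divff// gt_eqF// exprn_gt0.
Qed.

Let L2F : L2 F.
Proof. by apply/L2P; split => //; rewrite sqint_F ltry. Qed.

Let kernel_F x y : 0 < x -> 0 < y ->
  F x * (Kkernel 2 x y * F y) =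
  (2 * a) ^+ 2 * (x * y * (expR (- (a * (x + y))) * psi 2 (x + y))).
Proof.
move=> x0 y0; rewrite KkernelE// -/beta /F.
rewrite (mulrDr a) opprD expRD.
have := powR_betaM x0; have := powR_betaM y0.
move: (x `^ beta) (y `^ beta) (expR _) (expR _) (psi _ _) => p q e e' w.
by move=> {1}<- {1}<-; ring.
Qed.

Let psi20 s : 0 < s -> 0 <= psi 2 s.
Proof. exact: psi_ge0. Qed.

Let kernel_F_ge0 x y : 0 < x -> 0 < y -> 0 <= Kkernel 2 x y * F y.
Proof.
move=> x0 y0; rewrite mulr_ge0// KkernelE// mulr_ge0 ?psi20 ?addr_gt0//.
by rewrite mulr_ge0 ?powR_ge0.
Qed.

Let K_ge0 x : P x -> 0 <= K 2 F x.
Proof.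
move=> Px; rewrite /K patchE mem_set//.
by apply: Rintegral_ge0 => y Py; apply: kernel_F_ge0; rewrite -RplusE.
Qed.

Let pairing : (1 < \int[mu]_(x in P) (F x * K 2 F x)%:E)%E.
Proof.
have ltR12 : 1 < 2 :> R by rewrite ltr1n.
have major0 s : 0 < s -> 0 <= expR (- (a * s)) * psi 2 s.
  by move=> s0; rewrite mulr_ge0 ?expR_ge0 ?psi20.
have mFP : measurable_fun P F by exact: measurable_funTS.
have mk x : 0 < x -> measurable_fun P (fun y : TR => (Kkernel 2 x y * F y)%:E).
  move=> x0; apply/measurable_EFinP; apply: measurable_funM; last exact: mFP.
  exact: measurable_Kkernel_r.
have mKF : measurable_fun setT (K 2 F) by exact: measurable_K.
(* [K 2 F] passes through [fine], whereas Tonelli needs the extended real integral; by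
   [K_well_definedP] the two agree almost everywhere. *)
pose H x := ((F x)%:E * \int[mu]_(y in P) (Kkernel 2 x y * F y)%:E)%E.
have H0 x : P x -> (0 <= H x)%E.
  rewrite RplusE => x0; rewrite mule_ge0 ?lee_fin//.
  by apply: integral_ge0 => y; rewrite RplusE => y0; rewrite lee_fin kernel_F_ge0.
have mH : measurable_fun P H.
  apply: emeasurable_funM; first exact/measurable_EFinP.
  apply: (@measurable_integral_quadrant _
    (fun z : TR * TR => (Kkernel 2 z.1 z.2 * F z.2)%:E)).
    apply/measurable_EFinP; apply: measurable_funM; first exact: measurable_Kkernel.
    exact: (measurable_quadrant_snd mFP).
  by move=> x y; rewrite !RplusE lee_fin; exact: kernel_F_ge0.
rewrite (_ : (\int[mu]_(x in P) (F x * K 2 F x)%:E)%E = (\int[mu]_(x in P) H x)%E);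
    last first.
  apply: ge0_ae_eq_integral => //.
  - apply/measurable_EFinP; apply: measurable_funM => //; exact: measurable_funTS.
  - by move=> x Px; rewrite lee_fin mulr_ge0// K_ge0.
  have := ae_mu_plus_lebesgue (K_well_definedP ltR12 L2F).
  apply: filterS => x ix Px; rewrite /H EFinM; congr (_ * _)%E.
  rewrite /K patchE mem_set// /Rintegral fineK//.
  exact: integrable_fin_num (ix Px).
rewrite (_ : (\int[mu]_(x in P) H x)%E =
    (((2 * a) ^+ 2)%:E * dint (fun s => expR (- (a * s)) * psi 2 s)%R)%E).
  exact: dint_psi2_gt.
have := @dintZD R ((2 * a) ^+ 2) (fun s => expR (- (a * s)) * psi 2 s) (fun=> 0).
rewrite dint0 adde0 => <-//; last by rewrite sqr_ge0.
apply: eq_integral => x /set_mem; rewrite RplusE => x0.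
rewrite /H -ge0_integralZl//.
- apply: eq_integral => y /set_mem; rewrite RplusE => y0.
  by rewrite -EFinM kernel_F// addr0 mulrCA.
- exact: mk.
- by move=> y; rewrite RplusE => y0; rewrite lee_fin kernel_F_ge0.
- by rewrite lee_fin.
Qed.

Lemma opnorm_K2_gt1 : (1%:E < opnorm (K (2 : R)))%E.
Proof.
have ltR12 : 1 < 2 :> R by rewrite ltr1n.
have mKF : measurable_fun setT (K 2 F) by exact: measurable_K.
apply: (@lt_le_trans _ _ (L2norm (K 2 F))); last first.
  apply: ereal_sup_ubound; exists F => //; split => //.
  by rewrite L2normE// sqint_F poweR1r.
rewrite L2normE//.
(* By contradiction: if the squared norm of [K 2 F] were at most 1, integrated AM-GM would give
   [2 <K_2 F, F> <= 1 + 1], against [pairing]. *)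
have KF1 : (1 < sqint (K 2 F))%E.
  rewrite ltNge; apply/negP => KF1.
  have FK0 x : P x -> (0 <= (F x * K 2 F x)%:E)%E.
    by move=> Px; rewrite lee_fin mulr_ge0// K_ge0.
  have mFK : measurable_fun P (fun x : TR => (F x * K 2 F x)%:E).
    apply/measurable_EFinP; apply: measurable_funM; exact: measurable_funTS.
  have msq (G : TR -> R) : measurable_fun setT G ->
      measurable_fun P (fun x : TR => (G x ^+ 2)%:E).
    move=> mG; apply/measurable_EFinP; apply: measurable_funX.
    exact: measurable_funTS.
  have : (\int[mu]_(x in P) (F x * K 2 F x)%:E +
      \int[mu]_(x in P) (F x * K 2 F x)%:E <= sqint F + sqint (K 2 F))%E.
    rewrite /sqint -ge0_integralD// -ge0_integralD//; first last.
    - exact: msq.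
    - by move=> x _; rewrite lee_fin sqr_ge0.
    - exact: msq.
    - by move=> x _; rewrite lee_fin sqr_ge0.
    apply: ge0_le_integral => //.
    - by move=> x Px; rewrite adde_ge0 ?FK0.
    - exact: emeasurable_funD.
    - by apply: emeasurable_funD; exact: msq.
    - move=> x _; rewrite -!EFinD lee_fin -subr_ge0.
      rewrite (_ : _ - _ = (F x - K 2 F x) ^+ 2) ?sqr_ge0//; ring.
  rewrite sqint_F leNgt => /negP; apply.
  by apply: le_lt_trans (lteD pairing pairing); rewrite leeD2l.
move: KF1; case: (sqint (K 2 F)) => [r| |]//; last by rewrite poweRyr.
rewrite poweR_EFin !lte_fin => r1.
apply: (@le_lt_trans _ _ (1 `^ 2^-1)); first by rewrite powR1.
by apply: gt0_ltr_powR; rewrite ?nnegrE ?invr_gt0//; lra.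
Qed.

End TestFunction.

Theorem lemma4p4 (R : realType) :
  (forall alpha : R, 1 < alpha ->
     K_well_defined alpha /\ bounded_operator (K alpha)) /\
  [/\ ((Lambda (2 : R))%:E < opnorm (K (2 : R)))%E,
      Lambda (2 : R) = 1 &
      E R !=set0].
Proof.
split.
  by move=> alpha a1; split; [exact: K_well_definedP|exact: bounded_operator_K].
have L2 : ((Lambda (2 : R))%:E < opnorm (K (2 : R)))%E.
  by rewrite Lambda2; exact: opnorm_K2_gt1.
split; [exact: L2|exact: Lambda2|].
by exists 2; split => //; rewrite ltr1n.
Qed.
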